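(* Let $(X,d)$ be a complete, doubling, and quasiconvex metric space and let $K\subset X$ be an unbounded set. (a) Suppose there exists a constant $C>0$ such that, for every $x\in K$ and $0<r<\infty$, there is a closed connected set $\Gamma_{x,r}\subset X$ with $\Gamma_{x,r}\supseteq K\cap B_r(x)$ and $\mathcal H^1(\Gamma_{x,r})\le Cr$. Then there exists a (closed) connected set $\Gamma_0\in\mathrm{Reg}_1(C_0)$ with $\Gamma_0\supseteq K$, where $C_0$ depends only on the doubling and quasiconvexity constants of $(X,d)$ and on $C$. (b) Suppose there exists a constant $C>0$ such that, for every $x\in K$ and $0<r<\infty$, there is a set $A_{x,r}\subset[0,1]$ and a surjective $Cr$-Lipschitz map $f_{x,r}:A_{x,r}\to K\cap B_r(x)$. Then there exists a (closed) connected set $\Gamma_0\in\mathrm{Reg}_1(C_0)$ with $\Gamma_0\supseteq K$, where $C_0$ depends only on the doubling and quasiconvexity constants of $(X,d)$ and on $C$. (In both cases the further conclusions $\mathcal H^1(\Gamma_0)\lesssim\mathrm{diam}(K)$ and $\mathcal H^1(\Gamma_0)=\min\{\mathcal H^1(\Gamma):\Gamma \text{ closed and connected},\ \Gamma\supseteq K\}$ of the bounded case hold with both sides equal to $+\infty$.)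
   Context: $B_r(x)$ denotes the open ball. $(X,d)$ is quasiconvex with constant $L\ge 1$ if any $x,y\in X$ can be joined by a curve of length at most $L\,d(x,y)$. $(X,d)$ is doubling with constant $D\ge 1$ if for every $\varepsilon\in(0,1/2]$ every subset of $X$ of diameter $r$ can be covered by at most $\varepsilon^{-D}$ sets of diameter at most $\varepsilon r$. A set $E\subset X$ with $\mathrm{diam}(E)>0$ is $1$-regular with constant $C\ge1$, written $E\in\mathrm{Reg}_1(C)$, if it is closed and $C^{-1}r\le\mathcal H^1(B_r(x)\cap E)\le Cr$ for all $x\in E$ and $r\in(0,2\,\mathrm{diam}(E))$, where $\mathrm{diam}(E)=+\infty$ if $E$ is unbounded. *)

(* Defs.v *)
From HB Require Import structures.
From mathcomp Require Import all_boot all_order all_algebra.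
From mathcomp Require Import all_classical all_reals all_analysis.

Set Implicit Arguments.
Unset Strict Implicit.
Unset Printing Implicit Defensive.

Import Order.TTheory GRing.Theory Num.Theory.
Import numFieldNormedType.Exports.

Local Open Scope classical_set_scope.
Local Open Scope ring_scope.

(* The library's completeness structure is pointed, so these spaces are
   nonempty. *)
#[short(type="completeMetricType")]
HB.structure Definition CompleteMetric (R : numDomainType) :=
  {T of CompletePseudoMetric R T & Metric R T}.

Section metric_notions.
Context {R : realType} {X : metricType R}.
Implicit Types (A E K : set X) (x y : X).

(* Adding 0 to the set of distances gives diam set0 = 0 instead of -oo;
   unboundedness of A is diam A = +oo. *)
Definition diam A : \bar R :=
  ereal_sup (0%E |` [set (mdist p.1 p.2)%:E | p in A `*` A]).

Definition curve_variation (a b : R) (g : R -> X) (s : seq R) : R :=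
  let F := g \o nth b (a :: s) in
  \sum_(0 <= n < size s) mdist (F n) (F n.+1).

Definition curve_length (a b : R) (g : R -> X) : \bar R :=
  ereal_sup [set (curve_variation a b g s)%:E | s in itv_partition a b].

Definition hausdorff1_delta (delta : R) A : \bar R :=
  ereal_inf [set (\sum_(i <oo) diam (E i))%E | E in
    [set E : nat -> set X |
      A `<=` \bigcup_i E i /\ forall i, (diam (E i) <= delta%:E)%E]].

(* The normalizing constant of the 1-dimensional Hausdorff measure is 1. *)
Definition hausdorff1 A : \bar R :=
  ereal_sup [set hausdorff1_delta delta A | delta in [set delta | 0 < delta]].

Definition regular1 (C : R) E : Prop :=
  [/\ closed E, (0 < diam E)%E &
    forall x r, E x -> 0 < r -> (r%:E < 2%:E * diam E)%E ->
      ((C^-1 * r)%:E <= hausdorff1 (ball x r `&` E) <= (C * r)%:E)%E].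

Definition lipschitz_map_on (k : R) (A : set R) (f : R -> X) : Prop :=
  forall s t, A s -> A t -> mdist (f s) (f t) <= k * `|s - t|.

Definition closed_connected_cover K : set (set X) :=
  [set G | [/\ closed G, connected G & K `<=` G]].

End metric_notions.

Section space_properties.
Context {R : realType}.

Definition quasiconvex (L : R) (X : metricType R) : Prop :=
  forall x y : X, exists g : R -> X,
    [/\ {within `[0, 1], continuous g}, g 0 = x, g 1 = y &
      (curve_length 0 1 g <= (L * mdist x y)%:E)%E].

Definition doubling (D : R) (X : metricType R) : Prop :=
  forall (e : R) (A : set X), 0 < e -> e <= 2^-1 ->
    exists (n : nat) (B : 'I_n -> set X),
      [/\ n%:R <= e `^ (- D), A `<=` \bigcup_i B i &
        forall i, (diam (B i) <= e%:E * diam A)%E].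

End space_properties.

Definition is_minimum {R : realType} (S : set (\bar R)) (m : \bar R) : Prop :=
  S m /\ lbound S m.

(* Main.v *)
(* Proof idea.  Both hypotheses have the same discrete form (coverable): at each
   scale d, a d/2-separated part of K in a ball of radius t lies in a d-chain
   connected finite set with at most C t/d points.

   Let F be a finite set with this property, and V a d-chain connected set
   containing F of minimal cardinality.  Replacing the part of V in a ball by a
   set that joins up the points of F there and the vertices of V in the
   surrounding shell bounds the count in the ball by a small fraction of its
   growth plus a linear term, because doubling lets many shell vertices share
   their connections.  A count far above linear would then have to grow
   quadratically for ever; hence V meets every ball of radius t in at most C' t/d
   points.  Letting d tend to 0, an ultralimit of such sets is a compact connected
   set covering a bounded part of K and satisfying the upper regularity bound.

   For unbounded K a limit of connected sets could fall apart, so the bounded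
   pieces are glued: fix a base point x0 and a Whitney-type net Z of the complement
   of x0, with points z spaced c d(x0,z) apart, and let G z be such a piece for the
   part of K and Z in a small ball around z.  Pieces of neighbouring points meet,
   chains of them lead into x0, and G z stays at distance comparable to d(x0,z)
   from x0, so only boundedly many of them live at each scale. *)
Require Import Defs.
From HB Require Import structures.
From mathcomp Require Import all_boot all_order all_algebra.
From mathcomp Require Import all_classical all_reals all_analysis.
From mathcomp Require Import ring lra.

Set Implicit Arguments.
Unset Strict Implicit.
Unset Printing Implicit Defensive.

Import Order.TTheory GRing.Theory Num.Theory.
Import numFieldNormedType.Exports.

Local Open Scope classical_set_scope.
Local Open Scope ring_scope.

(** * Chain connected finite sets *)

Section chains.
Context {R : realType} {X : metricType R}.
Implicit Types (x y z : X) (s t V W Q : seq X) (d e r : R).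

(** Separation is asked of list positions, so for positive [e] a repeated entry is excluded and
    [size] counts points. *)
Definition spread e s := pairwise (fun x y => e <= mdist x y) s.

(* Chain connectedness without chains: a part of [V] that meets [V] and is closed
   under steps of length at most [d] is all of [V]. *)
Definition chained d V := forall B : set X,
  (exists2 x, x \in V & B x) ->
  (forall x y, x \in V -> B x -> y \in V -> mdist x y <= d -> B y) ->
  forall x, x \in V -> B x.

Lemma spread_uniq e s : 0 < e -> spread e s -> uniq s.
Proof.
move=> e0 /pairwise_uniq; apply => x /=.
by rewrite mdistxx leNgt e0.
Qed.

Lemma spreadP e s x y : x \in s -> y \in s -> spread e s -> x != y ->
  e <= mdist x y.
Proof.
elim: s => //= a s IH; rewrite !inE => /orP[/eqP ->|xs] /orP[/eqP ->|ys]
  /andP[/allP /= aall sp]; rewrite ?eqxx// => xy.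
- exact: aall.
- by rewrite metric_sym; apply: aall.
- exact: IH.
Qed.

Lemma spread_filter e (p : pred X) s : spread e s -> spread e [seq x <- s | p x].
Proof. exact: pairwise_filter. Qed.

Lemma maximal_spread_sub e s : 0 < e ->
  exists t, [/\ {subset t <= s}, spread e t &
    forall x, x \in s -> exists2 y, y \in t & mdist x y < e].
Proof.
move=> e0; elim: s => [|a s [t [ts tsp tn]]]; first by exists [::].
have [[y yt ay]|far] := pselect (exists2 y, y \in t & mdist a y < e).
  exists t; split => //; first by move=> x /ts xs; rewrite inE xs orbT.
  by move=> x; rewrite inE => /orP[/eqP ->|/tn//]; exists y.
exists (a :: t); split.
- by move=> x; rewrite !inE => /orP[->//|/ts ->]; rewrite orbT.
- rewrite /spread/= -/(spread e t) tsp andbT; apply/allP => y yt.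
  by rewrite leNgt; apply/negP => ay; apply: far; exists y.
- move=> x; rewrite inE => /orP[/eqP ->|/tn[y yt xy]].
    by exists a; rewrite ?mdistxx// inE eqxx.
  by exists y => //; rewrite inE yt orbT.
Qed.

(** Greedy extension stops because sizes are bounded by [m]; the induction runs on the remaining
    room [m - size s]. *)
Lemma maximal_spread e (A : set X) (m : nat) : 0 < e ->
  (forall s, spread e s -> [set` s] `<=` A -> (size s <= m)%N) ->
  exists s, [/\ spread e s, [set` s] `<=` A &
    forall x, A x -> exists2 y, y \in s & mdist x y < e].
Proof.
move=> e0 bnd.
suff: forall k s, spread e s -> [set` s] `<=` A -> (m - size s <= k)%N ->
    exists s, [/\ spread e s, [set` s] `<=` A &
      forall x, A x -> exists2 y, y \in s & mdist x y < e].
  by move=> /(_ m [::]); apply => //; rewrite leq_subr.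
elim=> [|k IH] s sp sA sk; have [near|] :=
  pselect (forall x, A x -> exists2 y, y \in s & mdist x y < e).
- by exists s.
- move=> /existsNP[x /not_implyP[Ax far]].
  have := bnd (x :: s); rewrite /spread/= -/(spread e s) sp andbT.
  have -> : all (fun y => e <= mdist x y) s.
    by apply/allP => y ys; rewrite leNgt; apply/negP => xy; apply: far; exists y.
  move=> /(_ isT); have xsA : [set` x :: s] `<=` A.
    by move=> y /=; rewrite inE => /orP[/eqP ->//|/sA].
  by move=> /(_ xsA); rewrite ltnNge -subn_eq0 -leqn0 sk.
- by exists s.
- move=> /existsNP[x /not_implyP[Ax far]].
  apply: (IH (x :: s)).
  + rewrite /spread/= -/(spread e s) sp andbT.
    by apply/allP => y ys; rewrite leNgt; apply/negP => xy; apply: far; exists y.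
  + by move=> y /=; rewrite inE => /orP[/eqP ->//|/sA].
  + by rewrite /= subnS -ltnS; move: sk; case: (m - size s)%N.
Qed.

Lemma chained_cat d V W x y : x \in V -> y \in W -> mdist x y <= d ->
  chained d V -> chained d W -> chained d (V ++ W).
Proof.
move=> xV yW xy cV cW B [z + Bz] stepB.
have stepV a b : a \in V -> B a -> b \in V -> mdist a b <= d -> B b.
  by move=> aV Ba bV; apply: stepB => //; rewrite mem_cat ?aV ?bV.
have stepW a b : a \in W -> B a -> b \in W -> mdist a b <= d -> B b.
  by move=> aV Ba bV; apply: stepB => //; rewrite mem_cat ?aV ?bV orbT.
have VtoB : (exists2 a, a \in V & B a) -> (forall a, a \in V -> B a).
  by move=> ex; apply: cV.
have WtoB : (exists2 a, a \in W & B a) -> (forall a, a \in W -> B a).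
  by move=> ex; apply: cW.
rewrite mem_cat => /orP[zV|zW] w; rewrite mem_cat => /orP[wV|wW].
- by apply: (VtoB _ _ wV); exists z.
- apply: (WtoB _ _ wW); exists y => //; apply: stepB xy.
  + by rewrite mem_cat xV.
  + by apply: (VtoB _ _ xV); exists z.
  + by rewrite mem_cat yW orbT.
- apply: (VtoB _ _ wV); exists x => //; apply: (stepB y).
  + by rewrite mem_cat yW orbT.
  + by apply: (WtoB _ _ yW); exists z.
  + by rewrite mem_cat xV.
  + by rewrite metric_sym.
- by apply: (WtoB _ _ wW); exists z.
Qed.

Lemma chained1 d x : chained d [:: x].
Proof. by move=> B [y]; rewrite inE => /eqP -> Bx _ z; rewrite inE => /eqP ->. Qed.

Lemma chained_cat_near d V s :
  chained d V -> (forall x, x \in s -> exists2 y, y \in V & mdist x y <= d) ->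
  chained d (V ++ s).
Proof.
move=> cV; elim: s V cV => [|a s IH] V cV near; first by rewrite cats0.
rewrite -cat1s catA; apply: IH.
  have [y yV ay] := near a (mem_head _ _).
  apply: (chained_cat yV (mem_head _ _)) => //; first by rewrite metric_sym.
  exact: chained1.
move=> x xs; have [|y yV xy] := near x; first by rewrite inE xs orbT.
by exists y => //; rewrite mem_cat yV.
Qed.

(** Each annulus of width [d] around [x] below the distance of [y] contains a vertex: if one were
    empty, no step of length at most [d] could jump over it, and [y] would be out of reach. *)
Lemma chained_ball_count d V x y (k : nat) : 0 < d -> chained d V ->
  x \in V -> y \in V -> k%:R * d <= mdist x y ->
  (k <= count (fun z => mdist x z < k%:R * d)%R V)%N.
Proof.
move=> d0 cV xV yV; elim: k => [//|k IH] kxy.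
have kd : k%:R * d <= k.+1%:R * d by rewrite ler_wpM2r ?(ltW d0)// ler_nat.
have {}IH := IH (le_trans kd kxy).
have [z zV /andP[z1 z2]] :
    exists2 z, z \in V & k%:R * d <= mdist x z < k.+1%:R * d.
  apply: contrapT => no.
  have noz z : z \in V -> mdist x z < k.+1%:R * d -> mdist x z < k%:R * d.
    by move=> zV zlt; rewrite ltNge; apply/negP => zge; apply: no; exists z;
      rewrite // zge zlt.
  suff : mdist x y < k.+1%:R * d by rewrite ltNge kxy.
  apply: (cV (fun z => mdist x z < k.+1%:R * d) _ _ y yV) => //.
    by exists x => //; rewrite mdistxx mulr_gt0.
  move=> u v uV ult vV uv; have := noz _ uV ult => {}ult.
  rewrite (le_lt_trans (metric_triangle _ u _))//.
  by rewrite -natr1 mulrDl mul1r ltr_leD.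
have zc : (0 < count (fun u => k%:R * d <= mdist x u < k.+1%:R * d)%R V)%N.
  by rewrite -has_count; apply/hasP; exists z => //; rewrite z1 z2.
rewrite (_ : count _ _ = (count (fun z => mdist x z < k%:R * d)%R V +
  count (fun u => k%:R * d <= mdist x u < k.+1%:R * d)%R V)%N).
  by have := leq_add IH zc; rewrite addn1.
rewrite -count_predUI [X in (_ + X)%N](_ : _ = 0%N) ?addn0.
  apply: eq_count => u /=; case: (ltP (mdist x u) (k%:R * d)) => //= uk.
  by rewrite (lt_le_trans uk kd).
apply/eqP; rewrite -leqn0 leqNgt -has_count; apply/hasPn => u _ /=.
by rewrite leNgt; case: (_ < _).
Qed.

Lemma chained_ball d V x y : 0 < d -> chained d V -> x \in V -> y \in V ->
  mdist x y < (size V).+1%:R * d.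
Proof.
move=> d0 cV xV yV; rewrite ltNge; apply/negP => /(chained_ball_count d0 cV xV yV).
by move=> /leq_trans/(_ (count_size _ _)); rewrite ltnn.
Qed.

Lemma ball_count_ge d e V x y : 0 < d -> chained d V -> x \in V -> y \in V ->
  e <= mdist x y ->
  e / d - 1 <= (count (fun z => mdist x z < e) V)%:R.
Proof.
move=> d0 cV xV yV exy; have [e0|e0] := leP 0 e; last first.
  by rewrite (@le_trans _ _ 0)// subr_le0 ler_pdivrMr// mul1r; lra.
have ed0 : 0 <= e / d by rewrite divr_ge0// ltW.
have /andP[k1 k2] := truncn_itv ed0; set k := Num.truncn _ in k1 k2.
have kd : k%:R * d <= e by rewrite -ler_pdivlMr.
have := chained_ball_count d0 cV xV yV (le_trans kd exy).
have : (count (fun z => mdist x z < k%:R * d)%R V <=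
        count (fun z => mdist x z < e)%R V)%N.
  by apply: sub_count => z /= /lt_le_trans; apply.
move=> /[swap] /leq_trans /[apply]; rewrite -(ler_nat R) -natr1 in k2 *.
by move=> ?; lra.
Qed.

End chains.

(** * Diameter, packing and curves *)

Section diameter.
Context {R : realType} {X : metricType R}.
Implicit Types (A B : set X) (x y : X).

Lemma diam_ge0 A : (0 <= diam A)%E.
Proof. by apply: ereal_sup_ubound; left. Qed.

Lemma mdist_diam A x y : A x -> A y -> ((mdist x y)%:E <= diam A)%E.
Proof. by move=> Ax Ay; apply: ereal_sup_ubound; right; exists (x, y). Qed.

Lemma diam_le A (M : R) : 0 <= M ->
  (forall x y, A x -> A y -> mdist x y <= M) -> (diam A <= M%:E)%E.
Proof.
move=> M0 AM; apply: ge_ereal_sup => _ [->|[[x y] [/= Ax Ay] <-]].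
  by rewrite lee_fin.
by rewrite lee_fin AM.
Qed.

Lemma diam_subset A B : A `<=` B -> (diam A <= diam B)%E.
Proof.
move=> AB; apply: ge_ereal_sup => _ [->|[[x y] [/= Ax Ay] <-]].
  exact: diam_ge0.
by apply: mdist_diam; apply: AB.
Qed.

Lemma diam0 : diam (@set0 X) = 0%E.
Proof. by apply/eqP; rewrite eq_le diam_ge0 diam_le. Qed.

Lemma mem_ball_mdist x r y : ball x r y = (mdist x y < r) :> Prop.
Proof. by rewrite ballEmdist. Qed.

End diameter.

(* Doubling at ratio [1 / (4 a)] splits a ball of radius [a * e] into sets of
   diameter less than [e]. *)
Definition packing_bound {R : realType} (D a : R) : R := (4 * a)^-1 `^ (- D).

Lemma packing_bound_gt0 {R : realType} (D a : R) : 0 < a -> 0 < packing_bound D a.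
Proof. by move=> a0; rewrite powR_gt0// invr_gt0 mulr_gt0. Qed.

Section packing.
Context {R : realType} {X : metricType R}.
Implicit Types (x y z : X) (s t V W Q : seq X) (d e r : R).

Lemma doubling_packing (D a e r : R) x s : doubling D X -> 1 <= a -> 0 < e ->
  r <= a * e -> spread e s -> (forall y, y \in s -> mdist x y <= r) ->
  (size s)%:R <= packing_bound D a.
Proof.
move=> dbl a1 e0 rae sp sr; have a0 : 0 < a by lra.
case: s => [|z0 s0] in sp sr *; first by rewrite powR_ge0.
set s := z0 :: s0 in sp sr *.
have r0 : 0 <= r by rewrite (le_trans (mdist_ge0 x z0))// sr// mem_head.
have [] := dbl (4 * a)^-1 [set` s].
- by rewrite invr_gt0 mulr_gt0.
- by rewrite lef_pV2 ?posrE; lra.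
move=> n [B [nD scov diamB]]; apply: le_trans nD.
have dB i : (diam (B i) <= (e / 2)%:E)%E.
  apply: le_trans (diamB i) _.
  apply: (@le_trans _ _ (((4 * a)^-1)%:E * (2 * r)%:E)%E).
    apply: lee_wpmul2l => //; first by rewrite lee_fin invr_ge0 mulr_ge0// ltW.
    apply: diam_le; first by rewrite mulr_ge0.
    move=> y z /sr xy /sr xz; rewrite (le_trans (metric_triangle _ x _))//.
    by rewrite metric_sym; lra.
  rewrite -EFinM lee_fin mulrC ler_pdivrMr ?mulr_gt0//.
  have -> : e / 2 * (4 * a) = 2 * (a * e) by field.
  by rewrite ler_pM2l.
(* Indices are natural numbers, since ['I_n] may be empty; points outside [s] get the default 0.
   Pieces of diameter at most [e / 2] hold at most one point of [s], so the choice is injective on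
   [s]. *)
have : forall z, exists i : nat, z \in s -> exists ilt : (i < n)%N, B (Ordinal ilt) z.
  move=> z; have [zs|_] := boolP (z \in s); last by exists 0%N.
  have [[i ilt] _ Bz] := scov z zs.
  by exists i => _; exists ilt.
move=> /choice[f fP].
rewrite ler_nat -(size_map f) -(size_iota 0 n); apply: uniq_leq_size.
  rewrite map_inj_in_uniq ?(spread_uniq e0 sp)// => y z ys zs fyz.
  apply/eqP/negPn/negP => yz.
  have [ilt By] := fP y ys; have [jlt Bz] := fP z zs.
  have := le_trans (mdist_diam By (_ : B (Ordinal ilt) z)) (dB _).
  rewrite leNgt lte_fin; move: (spreadP ys zs sp yz) => eyz /(_ _)/negP; apply.
    by move: Bz; congr (B _ _); apply/val_inj.
  by rewrite (lt_le_trans _ eyz)//; lra.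
by move=> _ /mapP[z zs ->]; rewrite mem_iota; have [] := fP z zs.
Qed.

Lemma connected_sub_open (G U U' : set X) : connected G -> open U -> open U' ->
  G `<=` U `|` U' -> (forall x, U x -> U' x -> False) -> G `&` U !=set0 -> G `<=` U.
Proof.
move=> cG oU oU' GUU' UU' GU0; have <- : G `&` U = G; last by move=> x [].
apply: cG => //; first by exists U.
exists (~` U'); first exact: open_closedC.
apply/seteqP; split => z [Gz]; first by move=> Uz; split => // /(UU' _ Uz).
by move=> nU'z; split => //; case: (GUU' z Gz).
Qed.

Lemma open_ball_mdist (q : X) e : open (ball q e).
Proof.
rewrite openE => z; rewrite mem_ball_mdist => qz.
apply/nbhs_ballP; exists (e - mdist q z) => /=; first by rewrite subr_gt0.
move=> w; rewrite /= !mem_ball_mdist => zw.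
by rewrite (le_lt_trans (metric_triangle _ z _))//; lra.
Qed.

(** The [e]-balls around the points of [s] inside [B] and outside [B] give two open sets covering
    [G]. They are disjoint, because centres of overlapping balls are one [d]-step apart;
    connectedness of [G] forbids such a splitting. *)
Lemma connected_chained (d e : R) (G : set X) s : connected G -> [set` s] `<=` G ->
  (forall x, G x -> exists2 y, y \in s & mdist x y < e) -> e *+ 2 <= d ->
  chained d s.
Proof.
move=> cG sG near ed B [x0 x0s Bx0] stepB.
have e0 : 0 < e.
  by have [y _ /(le_lt_trans (mdist_ge0 _ _))] := near _ (sG _ x0s).
pose U := \bigcup_(q in [set q | q \in s /\ B q]) ball q e.
pose U' := \bigcup_(q in [set q | q \in s /\ ~ B q]) ball q e.
have GU : G `<=` U.
  apply: (@connected_sub_open _ U U') => //.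
  - by apply: bigcup_open => q _; exact: open_ball_mdist.
  - by apply: bigcup_open => q _; exact: open_ball_mdist.
  - move=> z Gz; have [y ys yz] := near z Gz.
    have Byz : ball y e z by rewrite mem_ball_mdist metric_sym.
    by have [By|nBy] := pselect (B y); [left; exists y|right; exists y].
  - move=> z [q [qs Bq]]; rewrite /= mem_ball_mdist => qz.
    move=> [q' [qs' Bq']]; rewrite /= mem_ball_mdist => qz'.
    apply: Bq'; apply: stepB Bq _ _ => //.
    rewrite (le_trans (metric_triangle _ z _))// (le_trans _ ed)//.
    by rewrite mulr2n lerD ?(ltW qz)// metric_sym ltW.
  - exists x0; split; first exact: sG.
    by exists x0 => //=; exact: ballxx.
move=> y ys; have [q [qs Bq]] := GU y (sG y ys); rewrite /= mem_ball_mdist => qy.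
apply: stepB qs Bq ys _; apply: le_trans (ltW qy) _; apply: le_trans ed.
by rewrite mulr2n lerDl ltW.
Qed.

Lemma curve_variation_cons (a b c : R) (g : R -> X) (s : seq R) :
  curve_variation a b g (c :: s) = mdist (g a) (g c) + curve_variation c b g s.
Proof. by rewrite /curve_variation /= big_nat_recl. Qed.

Lemma curve_variation_spread (g : R -> X) (e a b : R) (t : seq R) :
  0 <= e -> path <%R a t -> {in a :: t, forall u, u <= b} ->
  {in a :: t &, forall u v, u != v -> e <= mdist (g u) (g v)} ->
  exists2 s, itv_partition a b s & (size t)%:R * e <= curve_variation a b g s.
Proof.
move=> e0; elim: t a => [|c t IH] a.
  move=> _ /(_ a (mem_head _ _)); rewrite le_eqVlt => /orP[/eqP ->|ab] _.
    by exists [::]; rewrite ?mul0r /curve_variation ?big_nil// /itv_partition.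
  exists [:: b]; first by rewrite /itv_partition /= ab.
  by rewrite mul0r curve_variation_cons /curve_variation big_nil addr0 mdist_ge0.
move=> /= /andP[ac ct] tb te; have [||s [sp sb] sv] := IH c ct.
- by move=> u uct; apply: tb; rewrite inE uct orbT.
- by move=> u v uct vct; apply: te; rewrite inE ?uct ?vct orbT.
exists (c :: s); first by rewrite /itv_partition /= ac.
rewrite curve_variation_cons -nat1r mulrDl mul1r lerD//.
by apply: te; rewrite ?inE ?eqxx ?orbT// lt_eqF.
Qed.

Lemma curve_length_spread (g : R -> X) (e : R) (t : seq R) : 0 <= e ->
  uniq t -> {in t, forall u, 0 <= u <= 1} ->
  {in t &, forall u v, u != v -> e <= mdist (g u) (g v)} ->
  ((((size t)%:R - 1) * e)%:E <= curve_length 0 1 g)%E.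
Proof.
move=> e0 ut t01 te.
suff [s sp tv] : exists2 s, itv_partition 0 1 s &
    ((size t)%:R - 1) * e <= curve_variation 0 1 g s.
  apply: le_trans (_ : (curve_variation 0 1 g s)%:E <= _)%E.
    by rewrite lee_fin.
  by apply: ereal_sup_ubound; exists s.
rewrite -(size_sort <=%R); have := mem_sort <=%R t.
have : sorted <%R (sort <=%R t) by rewrite lt_sorted_uniq_le sort_uniq ut sort_le_sorted.
case: (sort _ _) => [|a u] /= au tu.
  exists [:: 1]; first by rewrite /itv_partition /= ltr01.
  rewrite curve_variation_cons /curve_variation big_nil addr0.
  by rewrite (le_trans _ (mdist_ge0 _ _))// sub0r mulN1r oppr_le0.
have inu v : v \in a :: u -> v \in t by rewrite -tu.
have [||v vp vs] := curve_variation_spread (b := 1) (g := g) e0 au.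
- by move=> v /inu /t01 /andP[].
- by move=> v w /inu vt /inu wt; exact: te.
rewrite -natr1 addrK.
have /andP[+ _] := t01 a (inu _ (mem_head _ _)).
(* A partition does not list its left end, so the smallest parameter [a] is inserted only when it is
   not 0. *)
rewrite le_eqVlt => /orP[/eqP a0|a0]; first by exists v; rewrite a0.
case: vp => vp1 vp2; exists (a :: v); first by rewrite /itv_partition /= a0.
by rewrite curve_variation_cons (le_trans vs)// lerDr mdist_ge0.
Qed.

(** A maximal [d / 2]-separated subset of a short curve is [d]-chain connected, and the length of
    the curve bounds its size. Of the additive 3, one counts points against gaps and two are for the
    appended ends [x] and [y]. *)
Lemma quasiconvex_chain (L d : R) x y : quasiconvex L X -> 0 < d ->
  exists V, [/\ chained d V, x \in V, y \in V &
    (size V)%:R <= 2 * L * mdist x y / d + 3].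
Proof.
move=> /(_ x y)[g [cg g0 g1 gL]] d0; have d20 : 0 < d / 2 by lra.
pose G := g @` `[0, 1]%classic.
have cG : connected G.
  by apply: connected_continuous_connected cg; exact: segment_connected.
have bnd s : spread (d / 2) s -> [set` s] `<=` G ->
    (size s)%:R <= 2 * L * mdist x y / d + 1.
  move=> sp sG.
  have /choice[h hP] : forall z, exists u : R, z \in s -> 0 <= u <= 1 /\ g u = z.
    move=> z; have [zs|_] := boolP (z \in s); last by exists 0.
    by have [u + gu] := sG z zs; rewrite /= in_itv /= => u01; exists u.
  have us := spread_uniq d20 sp.
  have hinj : {in s &, injective h}.
    by move=> u v us' vs' huv; rewrite -(hP u us').2 huv (hP v vs').2.
  have := @curve_length_spread g (d / 2) (map h s) (ltW d20).
  rewrite map_inj_in_uniq// us => /(_ isT) lb.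
  have := le_trans (lb _ _) gL; rewrite lee_fin size_map => {}lb.
  suff : ((size s)%:R - 1) * (d / 2) <= L * mdist x y.
    by rewrite -lerBlDr ler_pdivlMr// => ?; lra.
  apply: lb.
  - by move=> _ /mapP[z zs ->]; have [] := hP z zs.
  - move=> _ _ /mapP[z zs ->] /mapP[w ws ->] zw.
    rewrite (hP z zs).2 (hP w ws).2; apply: spreadP sp _ => //.
    by apply: contra_neq zw => ->.
have [|s [sp sG snear]] := @maximal_spread _ _ (d / 2) G
    (Num.truncn (2 * L * mdist x y / d + 1)) d20.
  move=> s sp sG; have := bnd s sp sG => ss.
  by rewrite truncn_ge_nat// (le_trans _ ss).
have cs : chained d s.
  by apply: connected_chained cG sG snear _; rewrite mulr2n; lra.
have Gx : G x by exists 0; rewrite //= in_itv /= lexx ler01.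
have Gy : G y by exists 1; rewrite //= in_itv /= lexx ler01.
exists (s ++ [:: x; y]); split.
- apply: chained_cat_near => // z; rewrite !inE => zxy.
  have [|w ws zw] := snear z; first by case/orP: zxy => /eqP ->.
  by exists w => //; rewrite (ltW (lt_le_trans zw _))//; lra.
- by rewrite mem_cat !inE eqxx orbT.
- by rewrite mem_cat !inE eqxx !orbT.
- rewrite size_cat natrD /=; have := bnd s sp sG; lra.
Qed.

End packing.

(** * Lower bounds for the Hausdorff measure *)

Section hausdorff_lower_bound.
Context {R : realType} {X : metricType R}.
Implicit Types (x y z : X) (G A : set X) (s : seq X) (e r : R).

Lemma continuous_mdist x : continuous (mdist x : X -> R).
Proof.
move=> z; apply/cvgrPdist_lt => e e0.
apply/nbhs_ballP; exists e => //= w; rewrite mem_ball_mdist => zw.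
rewrite ltr_norml; have := metric_triangle x z w; have := metric_triangle x w z.
by rewrite (metric_sym w z) => ? ?; lra.
Qed.

Lemma connected_mdist_surj G x y (u : R) : connected G -> G x -> G y ->
  0 <= u <= mdist x y -> exists2 z, G z & mdist x z = u.
Proof.
move=> cG Gx Gy u01; have cfG : connected (mdist x @` G).
  apply: connected_continuous_connected cG _.
  exact/continuous_subspaceT/continuous_mdist.
have : (mdist x @` G) u.
  move/connected_intervalP : cfG => /(_ 0 (mdist x y)); apply => //.
  by exists x; rewrite ?mdistxx.
by move=> [z Gz <-]; exists z.
Qed.

(** The distance from [x] takes every value of [[0, r[] on [G], by connectedness. It maps each [E i]
    into an interval centred at the value of one of its points, hence of length twice the diameter;
    subadditivity of Lebesgue measure gives the bound with the factor 1/2. *)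
Lemma cover_diam_ge G x y r (E : nat -> set X) : connected G -> G x -> G y ->
  r <= mdist x y -> G `&` ball x r `<=` \bigcup_i E i ->
  ((r / 2)%:E <= \sum_(i <oo) diam (E i))%E.
Proof.
move=> cG Gx Gy rxy GE; have sum0 : (0 <= \sum_(i <oo) diam (E i))%E.
  by apply: nneseries_ge0 => i _ _; exact: diam_ge0.
have [r0|r0] := leP r 0; first by rewrite (le_trans _ sum0)// lee_fin; lra.
have [[i dEi]|fin] := pselect (exists i, diam (E i) = +oo%E).
  rewrite (@nneseries_pinfty _ _ predT i) ?leey// => n _; exact: diam_ge0.
have dEfin i : diam (E i) \is a fin_num.
  rewrite fin_numE; apply/andP; split; last by apply/eqP => dEi; apply: fin; exists i.
  by rewrite gt_eqF// (lt_le_trans _ (diam_ge0 _)).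
have /choice[F FP] : forall i, exists I : interval R,
    mdist x @` E i `<=` [set` I] /\
    (lebesgue_measure [set` I] <= 2%:E * diam (E i))%E.
  move=> i; have [[z Ez]|E0] := pselect (E i !=set0); last first.
    exists `]0, 0[; split; first by move=> u [w Ew _]; exfalso; apply: E0; exists w.
    by rewrite lebesgue_measure_itv /= ltxx mule_ge0// diam_ge0.
  pose d := fine (diam (E i)); have d0 : 0 <= d by rewrite fine_ge0// diam_ge0.
  exists `[mdist x z - d, mdist x z + d]; split.
    move=> _ [w Ew <-]; rewrite /= in_itv /=.
    have : mdist z w <= d by rewrite -lee_fin fineK// mdist_diam.
    have := metric_triangle x z w; have := metric_triangle x w z.
    by rewrite (metric_sym w z) => ? ? ?; apply/andP; split; lra.
  rewrite lebesgue_measure_itv /= lte_fin; case: ifPn => _; last first.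
    by rewrite mule_ge0// diam_ge0.
  by rewrite -[in leRHS](fineK (dEfin i)) -EFinM -EFinB lee_fin -/d; lra.
have cov : `[0%R, r[ `<=` \bigcup_i [set` F i].
  move=> u; rewrite /= in_itv /= => /andP[u0 ur].
  have [|z Gz xz] := connected_mdist_surj (u := u) cG Gx Gy.
    by rewrite u0 (le_trans (ltW ur)).
  have [|i _ Ez] := GE z; first by split => //; rewrite mem_ball_mdist xz.
  by exists i => //; apply: (FP i).1; exists z.
have : (lebesgue_measure [set` `[0%R, r[] <=
    \sum_(i <oo) lebesgue_measure [set` F i])%E.
  by apply: measure_sigma_subadditive => // i; exact: measurable_itv.
rewrite lebesgue_measure_itv /= lte_fin r0 sube0 => rF.
have {rF} : (r%:E <= 2%:E * \sum_(i <oo) diam (E i))%E.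
  apply: (le_trans rF); rewrite -nneseriesZl//; last by move=> ? _; exact: diam_ge0.
  by apply: lee_nneseries => // i _; exact: (FP i).2.
move: sum0; case: (\sum_(i <oo) _)%E => [q| |]//.
  by rewrite -EFinM !lee_fin => *; lra.
by move=> *; rewrite leey.
Qed.

Lemma hausdorff1_delta_le delta A : 0 < delta ->
  (hausdorff1_delta delta A <= hausdorff1 A)%E.
Proof. by move=> d0; apply: ereal_sup_ubound; exists delta. Qed.

Lemma hausdorff1_ball_ge G x y r : connected G -> G x -> G y ->
  r <= mdist x y -> ((r / 2)%:E <= hausdorff1 (ball x r `&` G))%E.
Proof.
move=> cG Gx Gy rxy; apply: le_trans (hausdorff1_delta_le _ ltr01).
apply: le_ereal_inf_tmp => _ [E [EG _] <-].
by apply: cover_diam_ge cG Gx Gy rxy _; rewrite setIC.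
Qed.

Lemma hausdorff1_ge G x y : connected G -> G x -> G y ->
  ((mdist x y / 2)%:E <= hausdorff1 G)%E.
Proof.
move=> cG Gx Gy; apply: le_trans (hausdorff1_delta_le _ ltr01).
apply: le_ereal_inf_tmp => _ [E [EG _] <-].
by apply: cover_diam_ge cG Gx Gy (lexx _) _ => z [/EG].
Qed.

(** Around each point of [s] the set [G] leaves the ball of radius [e / 4], which costs [e / 8] in
    any cover. A covering set of diameter at most [e / 4] meets only one of these balls, so the
    costs add up. A single point has no other point to reach, whence the [- 1]. *)
Lemma hausdorff1_spread G s e : connected G -> 0 < e -> spread e s ->
  [set` s] `<=` G -> ((((size s)%:R - 1) * (e / 8))%:E <= hausdorff1 G)%E.
Proof.
move=> cG e0 sp sG; have e40 : 0 < e / 4 by lra.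
apply: le_trans (hausdorff1_delta_le _ e40).
apply: le_ereal_inf_tmp => _ [E [EG dE] <-].
have us := spread_uniq e0 sp.
have [s1|s1] := leqP (size s) 1.
  apply: (@le_trans _ _ 0%E).
    by rewrite lee_fin mulr_le0_ge0 ?subr_le0 ?lern1//; lra.
  by apply: nneseries_ge0 => i _ _; exact: diam_ge0.
have qb q : q \in s ->
    ((e / 8)%:E <= \sum_(i <oo) diam (E i `&` ball q (e / 4)))%E.
  move=> qs; have [p ps pq] : exists2 p, p \in s & p != q.
    case: s us s1 {sp sG} qs => [|a [|b t]]//= /andP[+ _] _ _.
    rewrite inE negb_or => /andP[ab _]; have [aq|aq] := eqVneq a q.
      by exists b; rewrite ?inE ?eqxx ?orbT// -aq eq_sym.
    by exists a; rewrite ?inE ?eqxx.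
  have -> : e / 8 = (e / 4) / 2 by field.
  apply: (@cover_diam_ge G q p) => //; [exact: sG|exact: sG| |].
    by have := spreadP qs ps sp _; rewrite eq_sym => /(_ pq) ?; lra.
  by move=> z [/EG[i _ Ez] zb]; exists i.
apply: (@le_trans _ _ (\sum_(q <- s) \sum_(i <oo) diam (E i `&` ball q (e / 4)))%E).
  apply: (@le_trans _ _ (\sum_(q <- s) (e / 8)%:E)%E); last first.
    by rewrite big_seq [leRHS]big_seq; apply: lee_sum.
  rewrite sumEFin lee_fin big_const_seq count_predT iter_addr_0 -mulr_natr.
  by lra.
rewrite -nneseries_sum; last by move=> *; exact: diam_ge0.
apply: lee_nneseries => [i _ _|i _]; first by apply: sume_ge0 => *; exact: diam_ge0.
have [[q [qs [z [Ez qz]]]]|none] :=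
    pselect (exists q, q \in s /\ E i `&` ball q (e / 4) !=set0); last first.
  rewrite big_seq big1 ?diam_ge0// => q qs.
  suff -> : E i `&` ball q (e / 4) = set0 by exact: diam0.
  by apply/eqP/negPn/negP => /set0P ne; apply: none; exists q.
rewrite (bigD1_seq q)//= big1_seq ?adde0; first exact: diam_subset.
move=> p /andP[pq ps]; suff -> : E i `&` ball p (e / 4) = set0 by exact: diam0.
rewrite -subset0 => w [Ew].
rewrite mem_ball_mdist => pw; move: qz; rewrite mem_ball_mdist => qz.
have := spreadP qs ps sp; rewrite eq_sym => /(_ pq).
have := le_trans (mdist_diam Ez Ew) (dE i); rewrite lee_fin.
have := metric_triangle q z p; have := metric_triangle z w p.
by rewrite (metric_sym w p) => *; lra.
Qed.

End hausdorff_lower_bound.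

(** * Discrete form of the hypotheses *)

Section coverable.
Context {R : realType} {X : metricType R}.
Implicit Types (x y z : X) (F V W Q : seq X) (T K : set X) (d e r t : R).

(** The centre [y] ranges over all of [X], because the growth argument for minimal sets is run
    around arbitrary points; [Q] may leave both [T] and the ball. *)
Definition coverable (C : R) T := forall d F, 0 < d -> spread (d / 2) F ->
  [set` F] `<=` T -> forall y t, d <= t -> exists Q,
  [/\ chained d Q, forall x, x \in F -> mdist y x < t -> x \in Q &
      (size Q)%:R <= C * t / d].

Lemma chained_nil d : chained d ([::] : seq X).
Proof. by move=> B [x]. Qed.

(** If the ball around [y] contains a point [x] of [F], it lies in the ball of twice the radius
    around [x]; this is the factor 2. *)
Lemma coverable_centered (C : R) K : 0 <= C ->
  (forall x r d F, K x -> 0 < d -> d <= r -> spread (d / 2) F ->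
    [set` F] `<=` K `&` ball x r ->
    exists Q, [/\ chained d Q, {subset F <= Q} & (size Q)%:R <= C * r / d]) ->
  coverable (2 * C) K.
Proof.
move=> C0 cK d F d0 sp FK y t dt; pose F' := [seq x <- F | mdist y x < t].
have [[x xF']|none] := pselect (exists x, x \in F'); last first.
  exists [::]; split; first exact: chained_nil.
    by move=> x xF yx; exfalso; apply: none; exists x; rewrite mem_filter yx.
  by rewrite divr_ge0 ?mulr_ge0//; lra.
move: (xF'); rewrite mem_filter => /andP[yx xF].
have dt2 : d <= 2 * t by lra.
have F'K : [set` F'] `<=` K `&` ball x (2 * t).
  move=> z; rewrite /= mem_filter => /andP[yz zF]; split; first exact: FK.
  rewrite mem_ball_mdist (le_lt_trans (metric_triangle _ y _))//.
  by rewrite metric_sym; lra.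
have [Q [cQ FQ Qs]] := cK x (2 * t) d F' (FK x xF) d0 dt2 (spread_filter _ sp) F'K.
exists Q; split => //.
  by move=> z zF yz; apply: FQ; rewrite mem_filter yz.
by rewrite (mulrC 2) -(mulrA C).
Qed.

(** The chain is a maximal [d / 2]-separated subset of the continuum with [F] appended;
    [hausdorff1_spread] bounds the size of each of the two. *)
Lemma coverable_continua (C : R) K : 0 < C ->
  (forall x r, K x -> 0 < r ->
    exists2 G : set X, closed_connected_cover (K `&` ball x r) G &
      (hausdorff1 G <= (C * r)%:E)%E) ->
  coverable (2 * (2 + 32 * C)) K.
Proof.
move=> C0 GK; apply: coverable_centered; first lra.
move=> x r d F Kx d0 dr sp FK.
have [|G [_ cG KG] HG] := GK x r Kx; first lra.
have rd : 1 <= r / d by rewrite ler_pdivlMr ?mul1r.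
have bnd s : spread (d / 2) s -> [set` s] `<=` G -> (size s)%:R <= 1 + 16 * C * (r / d).
  move=> ssp sG; have d20 : 0 < d / 2 by lra.
  have := le_trans (hausdorff1_spread cG d20 ssp sG) HG; rewrite lee_fin => h.
  rewrite -lerBlDl mulrA ler_pdivlMr//; lra.
have [||Q [Qsp QG Qn]] := @maximal_spread _ _ (d / 2) G
    (Num.truncn (1 + 16 * C * (r / d))); first lra.
  move=> s ssp sG; have := bnd s ssp sG => ss.
  by rewrite truncn_ge_nat// (le_trans _ ss).
have cQ : chained d Q by apply: connected_chained cG QG Qn _; rewrite mulr2n; lra.
have FG : [set` F] `<=` G by move=> z /FK /KG.
exists (Q ++ F); split.
- apply: chained_cat_near => // z /FG /Qn[w wQ zw].
  by exists w => //; rewrite (ltW (lt_le_trans zw _))//; lra.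
- by move=> z zF; rewrite mem_cat zF orbT.
- rewrite size_cat natrD -mulrA; have := bnd _ Qsp QG; have := bnd _ sp FG.
  move=> ? ?; have : 0 <= C * (r / d) by rewrite mulr_ge0//; lra.
  lra.
Qed.

(** Images of consecutive parameters are joined by chains, and the lengths telescope. Since these
    images are at least [d / 2] apart, the additive 3 of each chain is absorbed into its Lipschitz
    bound, which turns [2 * L] into [2 * L + 6]. *)
Lemma lipschitz_chain (L k d : R) (A : set R) (f : R -> X) (a : R) (s : seq R) :
  quasiconvex L X -> 0 <= L -> 0 < d -> lipschitz_map_on k A f ->
  path <%R a s -> {in a :: s, forall u, A u} ->
  {in a :: s &, forall u v, u != v -> d / 2 <= mdist (f u) (f v)} ->
  exists Q, [/\ chained d Q, {in a :: s, forall u, f u \in Q} &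
    (size Q)%:R <= 1 + (2 * L + 6) * (k * (last a s - a) / d)].
Proof.
move=> qX L0 d0 lf; elim: s a => [|b s IH] a /=.
  move=> _ _ _; exists [:: f a]; split; first exact: chained1.
    by move=> u; rewrite !inE => /eqP ->.
  by rewrite subrr mulr0 mul0r mulr0 addr0.
move=> /andP[ab bs] As fs; have [||Q [cQ fQ Qs]] := IH b bs.
- by move=> u ubs; apply: As; rewrite inE ubs orbT.
- by move=> u v ubs vbs; apply: fs; rewrite inE ?ubs ?vbs orbT.
have [V [cV aV bV Vs]] := quasiconvex_chain (f a) (f b) qX d0.
exists (V ++ Q); split.
- by apply: (chained_cat bV (fQ b (mem_head _ _))) => //; rewrite mdistxx ltW.
- by move=> u; rewrite inE mem_cat => /orP[/eqP ->|/fQ ->]; rewrite ?aV ?orbT.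
rewrite size_cat natrD.
have aas : a \in a :: b :: s by rewrite mem_head.
have bas : b \in a :: b :: s by rewrite !inE eqxx orbT.
have dab : d / 2 <= mdist (f a) (f b) by apply: fs => //; rewrite lt_eqF.
have kab : mdist (f a) (f b) <= k * (b - a).
  have := lf a b (As a aas) (As b bas); rewrite distrC gtr0_norm//; lra.
have h1 : 1 <= 2 * (k * (b - a) / d) by rewrite mulrA ler_pdivlMr//; lra.
have h2 : 2 * L * mdist (f a) (f b) / d <= 2 * L * (k * (b - a) / d).
  by rewrite -mulrA ler_wpM2l ?mulr_ge0// ler_pM2r ?invr_gt0.
have -> : k * (last b s - a) / d = k * (last b s - b) / d + k * (b - a) / d.
  by field; lra.
lra.
Qed.

Lemma coverable_lipschitz (C L : R) K : quasiconvex L X -> 0 <= L -> 0 < C ->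
  (forall x r, K x -> 0 < r -> exists (A : set R) (f : R -> X),
    [/\ A `<=` `[0, 1], f @` A = K `&` ball x r & lipschitz_map_on (C * r) A f]) ->
  coverable (2 * (1 + (2 * L + 6) * C)) K.
Proof.
move=> qX L0 C0 GK; have LC : 0 <= (2 * L + 6) * C by rewrite mulr_ge0//; lra.
apply: coverable_centered; first lra.
move=> x r d F Kx d0 dr sp FK.
have [|A [f [A01 fA lf]]] := GK x r Kx; first lra.
have rd : 1 <= r / d by rewrite ler_pdivlMr ?mul1r.
have d20 : 0 < d / 2 by lra.
have /choice[h hP] : forall z, exists u : R, z \in F -> A u /\ f u = z.
  move=> z; have [zF|_] := boolP (z \in F); last by exists 0.
  by have := FK z zF; rewrite -fA => -[u Au <-]; exists u.
have us := spread_uniq d20 sp.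
have uh : uniq (map h F).
  rewrite map_inj_in_uniq// => u v uF vF huv.
  by rewrite -(hP u uF).2 huv (hP v vF).2.
have := mem_sort <=%R (map h F).
have : sorted <%R (sort <=%R (map h F)).
  by rewrite lt_sorted_uniq_le sort_uniq uh sort_le_sorted.
case: (sort _ _) => [_|a s].
  move=> F0; exists [::]; split; first exact: chained_nil.
    by move=> z zF; have := F0 (h z); rewrite map_f.
  by rewrite -mulrA mulr_ge0//; lra.
move=> /= ps sF.
have inF u : u \in a :: s -> exists2 z, z \in F & u = h z.
  by rewrite sF => /mapP[z zF ->]; exists z.
have [||Q [cQ fQ Qs]] := lipschitz_chain qX L0 d0 lf ps.
- by move=> u /inF[z zF ->]; exact: (hP z zF).1.
- move=> u v /inF[z zF ->] /inF[w wF ->] zw.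
  rewrite (hP z zF).2 (hP w wF).2; apply: spreadP sp _ => //.
  by apply: contra_neq zw => ->.
exists Q; split => //.
  by move=> z zF; rewrite -(hP z zF).2; apply: fQ; rewrite sF map_f.
have inA u : u \in a :: s -> 0 <= u <= 1.
  by move=> /inF[z zF ->]; have /A01 := (hP z zF).1; rewrite /= in_itv.
have /andP[a0 _] := inA a (mem_head _ _).
have /andP[_ l1] := inA _ (mem_last a s).
have h1 : C * r * (last a s - a) / d <= C * (r / d).
  rewrite mulrA ler_pM2r ?invr_gt0// ler_piMr//; last lra.
  by rewrite mulr_ge0; lra.
apply: (le_trans Qs).
have h2 : (2 * L + 6) * (C * r * (last a s - a) / d) <= (2 * L + 6) * (C * (r / d)).
  by rewrite ler_wpM2l//; lra.
by lra.
Qed.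

End coverable.

(** * Minimal chain connected sets *)

Section growth.
Context {R : realType}.

(* Doubling [n] quadruples [m n], which a bounded [m] cannot sustain: the
   increments are at least [3 (m n) / n] all the way from [n] to [2 n]. *)
Lemma growth_bound (m : nat -> R) (b B : R) (u0 : nat) : (0 < u0)%N -> 0 < b ->
  {homo m : i j / (i <= j)%N >-> i <= j} -> (forall n, m n <= B) ->
  (forall u, (u0 <= u)%N -> m u <= u%:R / 12 * (m u.+1 - m u) + b * u%:R) ->
  forall u, (u0 <= u)%N -> m u < 4 * b * u%:R.
Proof.
move=> u00 b0 mono mB rec n n0; rewrite ltNge; apply/negP => large.
have pos k : (u0 <= k)%N -> 0 < k%:R :> R by move=> uk; rewrite ltr0n (leq_trans u00).
have double k : (u0 <= k)%N -> 4 * b * k%:R <= m k -> 4 * m k <= m (k + k)%N.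
  move=> uk kl; have k0 := pos k uk.
  (* Linear interpolation of the quadrupling, which is the case [i = k]. *)
  suff step i : (i <= k)%N -> m k * (k%:R + 3 * i%:R) <= k%:R * m (k + i)%N.
    by rewrite -(ler_pM2l k0); have := step k (leqnn _); lra.
  elim: i => [_|i IH ik]; first by rewrite addn0 mulr0 addr0 mulrC.
  have {}IH := IH (ltnW ik).
  have := rec (k + i)%N (leq_trans uk (leq_addr _ _)).
  have := mono _ _ (leq_addr i k); rewrite addnS natrD -[i.+1%:R]natr1.
  have ik' : i%:R <= k%:R :> R by rewrite ler_nat ltnW.
  have i0 : 0 <= i%:R :> R by [].
  set q := m (k + i)%N in IH *; set q' := m (k + i).+1 => qk h.
  have bk : b * i%:R <= b * k%:R by rewrite ler_wpM2l// ltW.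
  (* As [i <= k] and [4 * b * k <= m k <= q], the linear term of the recursion is at most [q / 2],
     so the growth term carries the other half. *)
  have hq : m k * 6 <= (k%:R + i%:R) * (q' - q) by lra.
  have q'q : q <= q' by exact: mono.
  have : (k%:R + i%:R) * (q' - q) <= (2 * k%:R) * (q' - q).
    by rewrite ler_wpM2r//; lra.
  lra.
have mn0 : 0 < m n.
  by rewrite (lt_le_trans _ large)// !mulr_gt0// pos.
have iter_ k : exists j, [/\ (u0 <= j)%N, 4 * b * j%:R <= m j & k.+1%:R * m n <= m j].
  elim: k => [|k [j [uj jl kj]]]; first by exists n; rewrite mul1r.
  exists (j + j)%N; have dj := double j uj jl; split.
  - exact: leq_trans uj (leq_addr _ _).
  - have := pos j uj => j0; rewrite natrD mulrDr.
    have : 0 < 4 * b * j%:R by rewrite !mulr_gt0.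
    lra.
  - move: kj; rewrite -[in X in _ -> X]natr1 -[k.+1%:R]natr1 !mulrDl !mul1r.
    have : 0 <= k%:R * m n by rewrite mulr_ge0// ltW.
    lra.
have [j [_ _ kj]] := iter_ (Num.truncn (B / m n)).
have := truncnS_gt (B / m n); rewrite ltr_pdivrMr// => lt.
by have := mB j; lra.
Qed.

End growth.

Section steiner.
Context {R : realType}.

Lemma minimal_chained {X : metricType R} (d : R) (F W : seq X) :
  chained d W -> {subset F <= W} ->
  exists V, [/\ chained d V, {subset F <= V} &
    forall W, chained d W -> {subset F <= W} -> (size V <= size W)%N].
Proof.
move=> cW FW; pose P n := `[< exists V, [/\ chained d V, {subset F <= V} & size V = n] >].
have exP : exists n, P n by exists (size W); apply/asboolP; exists W.
case: (ex_minnP exP) => n /asboolP[V [cV FV Vn]] min; exists V; split => //.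
by move=> U cU FU; rewrite Vn; apply: min; apply/asboolP; exists U.
Qed.

(** Exchange argument: replacing the vertices in the ball by [Q] keeps the set chain connected and
    still containing [F], so minimality of [V] compares the two counts. *)
Lemma minimal_chained_ball {X : metricType R} (d : R) (F V Q : seq X) y t :
  chained d V -> {subset F <= V} ->
  (forall W, chained d W -> {subset F <= W} -> (size V <= size W)%N) ->
  chained d Q -> (forall v, v \in V -> t <= mdist y v < t + d -> v \in Q) ->
  (forall x, x \in F -> mdist y x < t -> x \in Q) ->
  (count (fun v => mdist y v < t)%R V <= size Q)%N.
Proof.
move=> cV FV min cQ shell FQ.
have [/hasP[v0 v0V v0t]|none] := boolP (has (fun v => mdist y v < t) V); last first.
  by move: none; rewrite has_count -leqNgt leqn0 => /eqP ->.
pose W := [seq v <- V | t <= mdist y v] ++ Q.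
have FW : {subset F <= W}.
  move=> x xF; rewrite mem_cat mem_filter; have [yx|yx] := ltP (mdist y x) t.
    by rewrite FQ ?orbT.
  by rewrite FV.
(* A step-closed part of [W] that misses [Q] has no vertex in the shell. Its vertices are at
   distance at least [t + d] from [y], so it is step-closed in [V] as well and would contain the
   vertex [v0] of the ball. *)
have outside (P : set X) x : x \in W -> P x -> (forall q, q \in Q -> ~ P q) ->
    (forall a b, a \in W -> P a -> b \in W -> mdist a b <= d -> P b) -> False.
  move=> xW Px PQ stepP.
  suff [_] : P v0 /\ t <= mdist y v0 by rewrite leNgt v0t.
  apply: (cV (fun v => P v /\ t <= mdist y v)) => //.
    move: xW; rewrite mem_cat mem_filter => /orP[/andP[tx xV]|xQ]; first by exists x.
    by have := PQ x xQ.
  move=> a b aV [Pa ta] bV ab.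
  have nq : a \notin Q by apply/negP => /PQ.
  have tda : t + d <= mdist y a.
    by rewrite leNgt; apply: contra nq => lt; apply: shell; rewrite ?ta.
  have tb : t <= mdist y b.
    by have := metric_triangle y b a; rewrite (metric_sym b a); lra.
  split=> //; apply: stepP Pa _ ab; rewrite mem_cat mem_filter ?ta ?aV//.
  by rewrite tb bV.
have cW : chained d W.
  move=> B [w wW Bw] stepB x xW; apply: contrapT => nBx.
  (* If [B] meets [Q] it contains [Q], and its complement misses [Q]; otherwise [B] itself misses
     [Q]. Either way [outside] applies. *)
  have [[q qQ Bq]|nBQ] := pselect (exists2 q, q \in Q & B q).
    apply: (outside (~` B) x) => //.
      move=> p pQ; apply; apply: cQ pQ; first by exists q.
      by move=> a b aQ Ba bQ; apply: stepB; rewrite // mem_cat ?aQ ?bQ orbT.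
    move=> a b aW nBa bW ab Bb; apply: nBa; apply: stepB Bb _ _ => //.
    by rewrite metric_sym.
  by apply: (outside B w) => // q qQ Bq; apply: nBQ; exists q.
have sV : size V = (count (fun v => t <= mdist y v)%R V +
    count (fun v => mdist y v < t)%R V)%N.
  rewrite -(count_predC (fun v => mdist y v < t)%R V) addnC; congr (_ + _)%N.
  by apply: eq_count => v /=; rewrite leNgt.
by have := min W cW FW; rewrite size_cat size_filter sV leq_add2l.
Qed.

Lemma chained_extend {X : metricType R} (L d r : R) (Q S : seq X) :
  quasiconvex L X -> 0 <= L -> 0 < d -> 0 <= r -> chained d Q ->
  (forall x, x \in S -> exists2 q, q \in Q & mdist q x <= r) ->
  exists Q', [/\ chained d Q', {subset Q <= Q'}, {subset S <= Q'} &
    (size Q')%:R <= (size Q)%:R + (size S)%:R * (2 * L * r / d + 3)].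
Proof.
move=> qX L0 d0 r0 cQ; elim: S => [_|x S IH near].
  by exists Q; split => //; rewrite mul0r addr0.
have [|Q' [cQ' QQ' SQ' Qs]] := IH.
  by move=> z zS; apply: near; rewrite inE zS orbT.
have [q qQ qx] := near x (mem_head _ _).
have [V [cV qV xV Vs]] := quasiconvex_chain q x qX d0.
exists (V ++ Q'); split.
- by apply: (chained_cat qV (QQ' q qQ)) => //; rewrite mdistxx ltW.
- by move=> z /QQ' zQ; rewrite mem_cat zQ orbT.
- by move=> z; rewrite inE mem_cat => /orP[/eqP ->|/SQ' ->]; rewrite ?xV ?orbT.
- rewrite size_cat natrD /= -natr1 mulrDl mul1r.
  have : 2 * L * mdist q x / d <= 2 * L * r / d.
    by rewrite ler_pM2r ?invr_gt0// ler_wpM2l// mulr_ge0.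
  lra.
Qed.

(* Vertices of [V] in the shell around the ball are first attached to a sparse
   net of the shell, whose cardinality is bounded by doubling; so each of them
   costs only a small fraction of the radius. *)
Lemma minimal_chained_shell {X : metricType R} (D L C d : R) (F V : seq X) y (u : nat) :
  doubling D X -> quasiconvex L X -> 1 <= L -> 0 <= C -> 0 < d -> (72 <= u)%N ->
  (forall y t, d <= t -> exists Q, [/\ chained d Q,
    forall x, x \in F -> mdist y x < t -> x \in Q & (size Q)%:R <= C * t / d]) ->
  chained d V -> {subset F <= V} ->
  (forall W, chained d W -> {subset F <= W} -> (size V <= size W)%N) ->
  let m (k : nat) : R := (count (fun v => mdist y v < k%:R * d)%R V)%:R in
  (m u <= u%:R / 12 * (m u.+1 - m u) +
    (C + 1 + packing_bound D (96 * L) * (6 * L + 1)) * u%:R : Prop).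
Proof.
move=> dX qX L1 C0 d0 u72 cF cV FV min m.
set M := packing_bound D (96 * L).
have M0 : 0 < M by rewrite packing_bound_gt0//; lra.
have u72R : 72 <= u%:R :> R by rewrite ler_nat.
set t : R := u%:R * d.
have dt : 72 * d <= t by rewrite ler_pM2r.
have td : t / d = u%:R by rewrite mulfK// gt_eqF.
have tS : u.+1%:R * d = t + d by rewrite -natr1 mulrDl mul1r.
pose S := [seq v <- V | t <= mdist y v < t + d].
have mS : m u.+1 - m u = (size S)%:R.
  rewrite /m tS -/t size_filter; apply/eqP; rewrite subr_eq -natrD; apply/eqP.
  congr _%:R; rewrite addnC -count_predUI [X in (_ + X)%N](_ : _ = 0%N) ?addn0.
    apply: eq_count => v /=; case: (ltP (mdist y v) t) => //= lt.
    by rewrite (lt_trans lt)// ltrDl.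
  apply/eqP; rewrite -leqn0 leqNgt -has_count; apply/hasPn => v _ /=.
  by rewrite leNgt; case: (_ < _).
have S0 : 0 <= (size S)%:R :> R by [].
have M1 : 0 <= M * (6 * L + 1) * u%:R by rewrite !mulr_ge0//; lra.
have C1 : 0 <= C * u%:R by rewrite mulr_ge0.
have uS : 0 <= u%:R / 12 * (size S)%:R :> R by rewrite !mulr_ge0.
rewrite mS.
have [/hasP[v0 v0V v0t]|none] := boolP (has (fun v => mdist y v < t) V); last first.
  move: none; rewrite has_count -leqNgt leqn0 => /eqP mu0.
  by rewrite /m -/t mu0; lra.
(* With this spacing a chain from a shell vertex to the net has at most [u / 24 + 3] points, which
   is at most [u / 12] since [72 <= u]. *)
pose e := t / (48 * L).
have e0 : 0 < e by rewrite divr_gt0//; lra.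
have [S' [S'S S'sp S'n]] := maximal_spread_sub S e0.
have S'M : (size S')%:R <= M.
  apply: (doubling_packing (x := y) (r := 2 * t) dX _ e0 _ S'sp); first lra.
    by have -> : 96 * L * e = 2 * t by rewrite /e; field; lra.
  by move=> v /S'S; rewrite mem_filter => /andP[/andP[_ vt] _]; lra.
have dt' : d <= t by lra.
(* The net is attached to a point of [Q0] in the ball. When [F] misses the ball the given [Q] may
   have no such point, and the single vertex [v0] replaces it. *)
have [Q0 [cQ0 FQ0 Q0s Q0b]] : exists Q, [/\ chained d Q,
    forall x, x \in F -> mdist y x < t -> x \in Q,
    (size Q)%:R <= C * u%:R + 1 & exists2 q, q \in Q & mdist y q < t].
  have [[x xF yx]|none] := pselect (exists2 x, x \in F & mdist y x < t).
    have [Q [cQ FQ Qs]] := cF y t dt'; exists Q; split => //.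
      by rewrite -mulrA td in Qs; lra.
    by exists x => //; exact: FQ.
  exists [:: v0]; split; first exact: chained1.
  - by move=> x xF yx; exfalso; apply: none; exists x.
  - by rewrite /= lerDr.
  - by exists v0 => //; rewrite mem_head.
have [q0 q0Q q0t] := Q0b.
have L0 : 0 <= L by lra.
have [||Q1 [cQ1 Q01 S'Q1 Q1s]] := chained_extend (r := 3 * t) (S := S') qX L0 d0 _ cQ0.
- lra.
- move=> v /S'S; rewrite mem_filter => /andP[/andP[_ vt] _]; exists q0 => //.
  by have := metric_triangle q0 y v; rewrite (metric_sym q0 y); lra.
have [|Q2 [cQ2 Q12 SQ2 Q2s]] := chained_extend (S := S) qX L0 d0 (ltW e0) cQ1.
  move=> v /S'n[w wS' vw]; exists w; first exact: S'Q1.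
  by rewrite metric_sym ltW.
have mQ : m u <= (size Q2)%:R.
  rewrite ler_nat; apply: (minimal_chained_ball cV FV min cQ2).
  - by move=> v vV vt; apply: SQ2; rewrite mem_filter vt vV.
  - by move=> x xF xt; apply/Q12/Q01/FQ0.
have Le : 2 * L * e / d = u%:R / 24.
  by rewrite -td /e; field; rewrite ?gt_eqF//; lra.
have L3 : 2 * L * (3 * t) / d = 6 * L * u%:R by rewrite -td; field; rewrite gt_eqF.
rewrite Le in Q2s; rewrite L3 in Q1s.
have h1 : (size S)%:R * (u%:R / 24 + 3) <= u%:R / 12 * (size S)%:R :> R.
  by rewrite mulrC ler_wpM2r//; lra.
have h2 : (size S')%:R * (6 * L * u%:R + 3) <= M * (6 * L * u%:R + 3).
  by rewrite ler_wpM2r// addr_ge0// !mulr_ge0.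
have h3 : M * (6 * L * u%:R + 3) <= M * (6 * L + 1) * u%:R.
  by rewrite -[leRHS]mulrA ler_wpM2l ?(ltW M0)//; lra.
lra.
Qed.

Lemma steiner_regular (D L C : R) : 1 <= L -> 0 <= C ->
  exists2 C', 1 <= C' & forall (X : metricType R) (d : R) (F : seq X),
  doubling D X -> quasiconvex L X -> 0 < d ->
  (forall y t, d <= t -> exists Q, [/\ chained d Q,
    forall x, x \in F -> mdist y x < t -> x \in Q & (size Q)%:R <= C * t / d]) ->
  exists V, [/\ chained d V, {subset F <= V},
    forall y t, d <= t -> (count (fun v => mdist y v < t)%R V)%:R <= C' * t / d &
    forall W, chained d W -> {subset F <= W} -> (size V <= size W)%N].
Proof.
move=> L1 C0; set M := packing_bound D (96 * L).
have M0 : 0 < M by rewrite packing_bound_gt0//; lra.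
set b := C + 1 + M * (6 * L + 1).
have b1 : 1 <= b.
  by rewrite /b -[C + 1]addrC -addrA lerDl addr_ge0// mulr_ge0 ?(ltW M0)//; lra.
(* 288 is 4 * 72: [growth_bound] contributes the 4, and rounding [t / d] up to an integer [u] that
   is at least 72 contributes the 72. *)
exists (288 * b); first lra.
move=> X d F dX qX d0 cF.
have [W0 cW0 FW0] : exists2 W, chained d W & {subset F <= W}.
  case: F cF => [|a F] cF; first by exists [::] => //; exact: chained_nil.
  pose r := \sum_(x <- a :: F) mdist a x + d.
  have [|Q [cQ FQ _]] := cF a r.
    by rewrite /r lerDr sumr_ge0// => *; exact: mdist_ge0.
  exists Q => // x xF; apply: FQ => //; rewrite /r (big_rem x)//= -addrA ltrDl.
  by rewrite ltr_wpDl// sumr_ge0// => *; exact: mdist_ge0.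
have [V [cV FV min]] := minimal_chained cW0 FW0; exists V; split => // y t dt.
pose m (k : nat) : R := (count (fun v => mdist y v < k%:R * d)%R V)%:R.
have mono : {homo m : i j / (i <= j)%N >-> i <= j}.
  move=> i j ij; rewrite ler_nat; apply: sub_count => v /= /lt_le_trans; apply.
  by rewrite ler_pM2r// ler_nat.
have td : 1 <= t / d by rewrite ler_pdivlMr ?mul1r.
pose u := maxn 72 (Num.truncn (t / d)).+1.
have u72 : (72 <= u)%N by rewrite leq_maxl.
have mu : m u < 4 * b * u%:R.
  apply: (growth_bound (B := (size V)%:R) (u0 := 72)) => //; first lra.
    by move=> n; rewrite ler_nat count_size.
  by move=> k k72; exact: (minimal_chained_shell y dX qX L1 C0 d0 k72 cF cV FV min).
apply: (@le_trans _ _ (m u)).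
  rewrite ler_nat; apply: sub_count => v /= /lt_le_trans; apply.
  rewrite -ler_pdivrMr// (le_trans (ltW (truncnS_gt _)))// ler_nat.
  by rewrite leq_maxr.
have : u%:R <= 72 * (t / d).
  have td0 : 0 <= t / d by lra.
  have /andP[tr _] := truncn_itv td0.
  by rewrite /u natr_max ge_max -[_.+1%:R]natr1; apply/andP; split; lra.
rewrite -(ler_pM2l (_ : 0 < 4 * b)); last lra.
lra.
Qed.

End steiner.

(** * Ultralimits *)

Section ultralimit.
Context {R : realType} {X : completeMetricType R}.
Implicit Types (x y z p : X) (s : seq X) (T : set X) (d e r : R).

(** Discrete form of upper regularity: it survives limits and gluing, and [hausdorff1_packed] turns
    it into a bound on the measure. *)
Definition packed (C : R) T := forall y e r s, 0 < e -> e <= r -> spread e s ->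
  [set` s] `<=` T `&` ball y r -> (size s)%:R <= C * r / e.

Lemma closed_mdist T p : closed T ->
  (forall e, 0 < e -> exists2 x, T x & mdist p x < e) -> T p.
Proof.
move=> cT near; apply: cT => B /nbhs_ballP[e /= e0 eB].
have [x Tx px] := near e e0; exists x; split => //; apply: eB.
by rewrite mem_ball_mdist.
Qed.

Lemma ultra_seq (I : eqType) (U : set_system nat) (s : seq I) (P : I -> set nat) :
  UltraFilter U -> U (fun n => exists2 i, i \in s & P i n) ->
  exists2 i, i \in s & U (P i).
Proof.
move=> UU; elim: s => [|a s IH] Us.
  by have [n [i]] := filter_ex Us.
have [Ua|Una] := in_ultra_setVsetC (P a) UU; first by exists a; rewrite ?mem_head.
have [|i si Ui] := IH; last by exists i => //; rewrite inE si orbT.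
apply: filterS (filterI Us Una) => n [[i]]; rewrite inE => /orP[/eqP -> //|si Pi _].
by exists i.
Qed.

(** By doubling the ball has a finite [e]-net for every [e]; the ultrafilter selects one net point,
    so the image filter is Cauchy and completeness applies. *)
Lemma ultra_limit (D : R) (U : set_system nat) (w : nat -> X) z r :
  doubling D X -> UltraFilter U -> (forall n, mdist z (w n) <= r) ->
  exists l, forall e, 0 < e -> \forall n \near U, mdist l (w n) < e.
Proof.
move=> dX UU wr.
have r0 : 0 <= r by apply: le_trans (wr 0%N); exact: mdist_ge0.
suff : cvg (w @ U).
  move=> /cvg_ex[l wl]; exists l => e e0.
  have Ul : U (fun n => ball l e (w n)) by exact: (wl (ball l e) (nbhsx_ballx l e e0)).
  by apply: filterS Ul => n; rewrite mem_ball_mdist.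
apply: cauchy_cvg; apply: cauchy_exP => e e0.
pose a := (r / e) + 1.
have a1 : 1 <= a by rewrite lerDr divr_ge0// ltW.
have ra : r <= a * e by rewrite mulrDl mul1r divfK ?gt_eqF// lerDl ltW.
have [|s [_ _ sn]] := @maximal_spread _ _ e [set y | mdist z y <= r]
    (Num.truncn (packing_bound D a)) e0.
  move=> s sp sr; rewrite truncn_ge_nat ?powR_ge0//.
  exact: (doubling_packing (x := z) dX a1 e0 ra sp).
have [|y ys Uy] := @ultra_seq _ U s (fun y n => mdist (w n) y < e) UU.
  by apply: filterS filterT => n _; exact: (sn (w n) (wr n)).
exists y; suff : U (fun n => ball y e (w n)) by [].
by apply: filterS Uy => n wy; rewrite mem_ball_mdist metric_sym.
Qed.

(** The Kuratowski limit along [U]; for an ultrafilter the lower and upper limits coincide. *)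
Definition limit_set (U : set_system nat) (V : nat -> seq X) : set X :=
  [set p | forall e, 0 < e -> \forall n \near U, exists2 v, v \in V n & mdist p v < e].

Section limit_set.
Context (D : R) (U : set_system nat) (V : nat -> seq X) (d : nat -> R) (z : X) (r : R).
Context (dX : doubling D X) (UU : UltraFilter U) (Uoo : \oo `<=` U).
Context (d0 : forall n, 0 < d n)
  (dU : forall e, 0 < e -> \forall n \near U, d n < e).
Context (cV : forall n, chained (d n) (V n)).

Lemma closed_limit_set : closed (limit_set U V).
Proof.
move=> p clp e e0; have e20 : 0 < e / 2 by lra.
have [q [Gq]] := clp _ (nbhsx_ballx p _ e20); rewrite mem_ball_mdist => pq.
apply: filterS (Gq _ e20) => n [v vV qv]; exists v => //.
by have := metric_triangle p q v; lra.
Qed.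

Lemma limit_set_bounded p : (forall n v, v \in V n -> mdist z v <= r) ->
  limit_set U V p -> mdist z p <= r.
Proof.
move=> Vr Gp; apply/ler_addgt0Pr => e e0.
have [n [v vV pv]] := filter_ex (Gp e e0).
have := Vr n v vV; have := metric_triangle z v p; rewrite (metric_sym v p); lra.
Qed.

Lemma separated_gap (A B : set X) : closed A -> closed B -> A `&` B = set0 ->
  (forall x, A x -> mdist z x <= r) -> exists2 e : R, 0 < e &
  forall a b, A a -> B b -> e <= mdist a b.
Proof.
move=> cA cB AB Ar; apply: contrapT => nogap.
have near e : 0 < e -> exists ab : X * X, [/\ A ab.1, B ab.2 & mdist ab.1 ab.2 < e].
  move=> e0; apply: contrapT => none; apply: nogap; exists e => // a b Aa Bb.
  by rewrite leNgt; apply/negP => lt; apply: none; exists (a, b).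
have /choice[f fP] : forall n : nat, exists ab : X * X,
    [/\ A ab.1, B ab.2 & mdist ab.1 ab.2 < n.+1%:R^-1].
  by move=> n; apply: near; rewrite invr_gt0.
have [|l ll] := @ultra_limit D U (fun n => (f n).1) z r dX UU.
  by move=> n; apply: Ar; have [] := fP n.
have Al : A l.
  apply: closed_mdist => // e e0; have [n lt] := filter_ex (ll e e0).
  by exists (f n).1 => //; have [] := fP n.
have Bl : B l.
  apply: closed_mdist => // e e0; have e20 : 0 < e / 2 by lra.
  have nU : \forall n \near U, n.+1%:R^-1 < e / 2.
    by apply: Uoo; exact: (near_infty_natSinv_lt (PosNum e20)).
  have [n [/= lt ne]] := filter_ex (filterI (ll _ e20) nU).
  have [_ Bn fn] := fP n; exists (f n).2 => //.
  have := lt_trans fn ne; have := metric_triangle l (f n).1 (f n).2; lra.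
by have : (A `&` B) l by []; rewrite AB.
Qed.

Lemma connected_limit_set : (forall n v, v \in V n -> mdist z v <= r) ->
  connected (limit_set U V).
Proof.
move=> Vr; set G := limit_set U V.
move=> A [a0 Aa0] [W oW AW] [C cC AC]; apply: contrapT => AG.
have AsG : A `<=` G by rewrite AW => x [].
have [b0 Gb0 nAb0] : exists2 b, G b & ~ A b.
  apply: contrapT => none; apply: AG; apply/seteqP; split => // b Gb.
  by apply: contrapT => nA; apply: none; exists b.
move=> {AG}; pose B := G `&` ~` W.
have cG : closed G by exact: closed_limit_set.
have cA : closed A by rewrite AC; exact: closedI.
have cB : closed B by apply: closedI => //; exact: open_closedC.
have AB : A `&` B = set0 by rewrite -subset0 AW => x [[_ Wx] [_]].
have GAB x : G x -> A x \/ B x.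
  by move=> Gx; have [Wx|nWx] := pselect (W x); [left; rewrite AW|right].
have [|e5 e50 gap] := separated_gap cA cB AB.
  by move=> x /AsG; exact: limit_set_bounded.
move=> {AB AW AC}; pose e := e5 / 5; have e0 : 0 < e by rewrite /e; lra.
(* If every vertex were within [2 * e] of [A] or of [B], those near [A] would be closed under steps
   shorter than [e], since the gap is [5 * e]; but [V n] comes near both sides. A limit of far
   vertices would lie in [G] and yet stay away from it. *)
have far : \forall n \near U, exists2 w, w \in V n & forall x, G x -> 2 * e <= mdist x w.
  have nA := AsG _ Aa0 e e0; have nB := Gb0 e e0.
  apply: filterS (filterI (filterI nA nB) (dU e0)) => n [[[v vV av] [u uV bu]] dn].
  apply: contrapT => none.
  have near w : w \in V n -> (exists2 x, A x & mdist x w < 2 * e) \/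
      (exists2 x, B x & mdist x w < 2 * e).
    move=> wV; apply: contrapT => /not_orP[nA' nB']; apply: none; exists w => // x Gx.
    rewrite leNgt; apply/negP => lt; have [Ax|Bx] := GAB x Gx.
      by apply: nA'; exists x.
    by apply: nB'; exists x.
  have [x Ax xu] : exists2 x, A x & mdist x u < 2 * e.
    apply: (cV (B := fun w => exists2 x, A x & mdist x w < 2 * e)) uV.
      by exists v => //; exists a0 => //; lra.
    move=> p q pV [x Ax xp] qV pq; have [//|[y By yq]] := near q qV.
    have := gap x y Ax By; have := metric_triangle x p y.
    have := metric_triangle p q y; rewrite (metric_sym q y) -/e => *.
    by exfalso; rewrite /e in xp yq dn *; lra.
  have Bb0 : B b0 by have [] := GAB b0 Gb0.
  have := gap x b0 Ax Bb0; have := metric_triangle x u b0.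
  by rewrite (metric_sym u b0) => *; rewrite /e in xu bu; lra.
(* The default [z] is used for indices without a far vertex, to keep the whole sequence bounded. *)
have /choice[w wP] : forall n, exists w, mdist z w <= r /\
    ((exists2 w, w \in V n & forall x, G x -> 2 * e <= mdist x w) ->
      w \in V n /\ forall x, G x -> 2 * e <= mdist x w).
  move=> n; have [[w wV wfar]|none] :=
      pselect (exists2 w, w \in V n & forall x, G x -> 2 * e <= mdist x w).
    by exists w; split => //; exact: Vr wV.
  exists z; split => //; rewrite mdistxx.
  by rewrite (le_trans (mdist_ge0 z a0))//; apply/limit_set_bounded/AsG.
have [|l ll] := @ultra_limit D U w z r dX UU; first by move=> n; exact: (wP n).1.
have Gl : G l.
  move=> e' e'0; apply: filterS (filterI (ll e' e'0) far) => n [lw ex].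
  by exists (w n) => //; exact: ((wP n).2 ex).1.
have [n [lw ex]] := filter_ex (filterI (ll e e0) far).
by have := ((wP n).2 ex).2 l Gl; lra.
Qed.

Lemma spread_count e s (a : R) (W : seq X) : 0 <= a -> spread e s ->
  (forall x, x \in s -> a <= (count (fun v => mdist x v < e / 2)%R W)%:R) ->
  (size s)%:R * a <= (count (fun v => has (fun x => mdist x v < e / 2)%R s) W)%:R.
Proof.
move=> a0; elim: s => [|x s IH] /=; first by rewrite mul0r.
move=> /andP[/allP xs sp] cnt; rewrite -natr1 mulrDl mul1r.
rewrite (_ : count _ W = (count (fun v => has (fun x => mdist x v < e / 2)%R s) W +
  count (fun v => mdist x v < e / 2)%R W)%N).
  rewrite natrD lerD//; last by apply: cnt; rewrite mem_head.
  by apply: IH => // y ys; apply: cnt; rewrite inE ys orbT.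
rewrite -count_predUI [X in (_ + X)%N](_ : _ = 0%N) ?addn0.
  by apply: eq_count => v /=; rewrite orbC.
apply/eqP; rewrite -leqn0 leqNgt -has_count; apply/hasPn => v _ /=.
apply/negP => /andP[/hasP[y ys yv] xv].
have := xs y ys; have := metric_triangle x v y; rewrite (metric_sym v y) => ? /=.
by lra.
Qed.

(** For fine [n] the set [V n] passes near each point of [s] and on to another one, so it has at
    least [e / (8 * d n)] vertices in the ball of radius [e / 2] around it. These balls are disjoint
    and lie in the ball of radius [2 * t], whence 16 = 8 * 2; a single point is treated apart. *)
Lemma packed_limit_set (C : R) : 1 <= C ->
  (forall n y t, d n <= t -> (count (fun v => mdist y v < t)%R (V n))%:R <= C * t / d n) ->
  packed (16 * C) (limit_set U V).
Proof.
move=> C1 cnt y e t s e0 et sp sG.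
have te : 1 <= t / e by rewrite ler_pdivlMr ?mul1r.
have [s1|s1] := leqP (size s) 1.
  have : (size s)%:R <= 1 :> R by rewrite lern1.
  have : 1 * 1 <= C * (t / e) by rewrite ler_pM.
  by rewrite -mulrA; lra.
have [n [dn sn]] : exists n, d n < e / 16 /\
    forall x, x \in s -> exists2 v, v \in V n & mdist x v < e / 8.
  have e80 : 0 < e / 8 by lra.
  have e160 : 0 < e / 16 by lra.
  suff near : \forall n \near U, forall x, x \in s -> exists2 v, v \in V n & mdist x v < e / 8.
    by have [n [? ?]] := filter_ex (filterI (dU e160) near); exists n.
  elim: s {sp s1} sG => [|x s IH] sG; first by apply: filterS filterT.
  have Gx : limit_set U V x by have [] := sG x (mem_head _ _).
  have {}IH := IH (fun x xs => sG x (mem_behead (xs : x \in behead (_ :: s)))).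
  apply: filterS (filterI (Gx _ e80) IH) => n [nx ns] w.
  by rewrite inE => /orP[/eqP ->|/ns].
have dn0 := d0 n.
have ed : 16 <= e / d n by rewrite ler_pdivlMr//; lra.
have cs x : x \in s -> e / d n / 8 <= (count (fun v => mdist x v < e / 2)%R (V n))%:R.
  move=> xs; have us := spread_uniq e0 sp.
  have [x' x's xx'] : exists2 x', x' \in s & x' != x.
    case: s us s1 {sp sG sn} xs => [|a [|b u]]//= /andP[+ _] _ _.
    rewrite inE negb_or => /andP[ab _]; have [ax|ax] := eqVneq a x.
      by exists b; rewrite ?inE ?eqxx ?orbT// -ax eq_sym.
    by exists a; rewrite ?inE ?eqxx.
  have [v vV xv] := sn x xs; have [v' v'V xv'] := sn x' x's.
  have exx' : e <= mdist x x' by apply: spreadP sp _ => //; rewrite eq_sym.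
  have vv' : e / 4 <= mdist v v'.
    have := metric_triangle x v x'; have := metric_triangle v v' x'.
    by rewrite (metric_sym v' x') => *; lra.
  have := ball_count_ge dn0 (@cV n) vV v'V vv'.
  have : (count (fun w => mdist v w < e / 4)%R (V n) <=
          count (fun w => mdist x w < e / 2)%R (V n))%N.
    by apply: sub_count => w /= vw; have := metric_triangle x v w; lra.
  by rewrite -(ler_nat R) => ? ?; lra.
have ed0 : 0 <= e / d n / 8 by lra.
have := spread_count ed0 sp cs.
have dt : d n <= 2 * t by lra.
have := cnt n y (2 * t) dt.
have : (count (fun v => has (fun x => mdist x v < e / 2)%R s) (V n) <=
        count (fun v => mdist y v < 2 * t)%R (V n))%N.
  apply: sub_count => w /= /hasP[x xs xw]; have [_] := sG x xs.
  by rewrite mem_ball_mdist => yx; have := metric_triangle y x w; lra.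
rewrite -(ler_nat R) => h1 h2 h3.
have : (size s)%:R * (e / d n / 8) <= C * (2 * t) / d n by lra.
rewrite ler_pdivlMr//.
have -> : (size s)%:R * (e / d n / 8) * d n = (size s)%:R * e / 8 by field; rewrite gt_eqF.
by rewrite ler_pdivlMr//; lra.
Qed.

End limit_set.
End ultralimit.

Lemma bounded_cover {R : realType} (D L C : R) : 1 <= L -> 0 <= C ->
  exists2 C', 1 <= C' & forall (X : completeMetricType R) (T : set X) z (r : R),
  doubling D X -> quasiconvex L X -> coverable C T -> T z -> 0 < r ->
  T `<=` ball z r ->
  exists G, [/\ closed G, connected G, T `<=` G,
    forall p, G p -> mdist z p <= (C + 2) * r & packed C' G].
Proof.
move=> L1 C0; have [C' C'1 steiner] := steiner_regular D L1 C0.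
exists (16 * C'); first lra.
move=> X T z r dX qX cT Tz r0 Tr.
pose d (n : nat) : R := r / n.+1%:R.
have d0 n : 0 < d n by rewrite divr_gt0.
have dr n : d n <= r by rewrite ler_pdivrMr// ler_pMr// ler1n.
have /choice[V VP] : forall n, exists V : seq X, [/\ chained (d n) V,
    forall v, v \in V -> mdist z v <= (C + 2) * r,
    forall p, T p -> exists2 v, v \in V & mdist p v < d n &
    forall y t, d n <= t -> (count (fun v => mdist y v < t)%R V)%:R <= C' * t / d n].
  move=> n; have d20 : 0 < d n / 2 by rewrite divr_gt0.
  have rd : r <= (2 * n.+1%:R) * (d n / 2).
    by rewrite /d (_ : _ * _ = r)//; field.
  have n1 : 1 <= 2 * n.+1%:R :> R by rewrite -natrM ler1n.
  have [|F [Fsp FT Fn]] := @maximal_spread _ _ (d n / 2) T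
      (Num.truncn (packing_bound D (2 * n.+1%:R))) d20.
    move=> s sp sT; rewrite truncn_ge_nat ?powR_ge0//.
    apply: (doubling_packing (x := z) dX n1 d20 rd sp) => y ys.
    by have := Tr _ (sT y ys); rewrite mem_ball_mdist => /ltW.
  have [V [cV FV Vc min]] := steiner X (d n) F dX qX (d0 n)
    (fun y t dt => cT _ F (d0 n) Fsp FT y t dt).
  exists V; split => //; last first.
    move=> p Tp; have [f fF pf] := Fn p Tp; exists f; first exact: FV.
    by have := d0 n; lra.
  have [Q [cQ FQ Qs]] := cT _ F (d0 n) Fsp FT z r (dr n).
  (* All of [F] lies in the ball around [z], so [Q] competes with [V]. The bound on the number of
     vertices then bounds how far the chain can reach. *)
  have VQ : (size V <= size Q)%N.
    apply: min => // x xF; apply: FQ => //.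
    by have := Tr _ (FT x xF); rewrite mem_ball_mdist.
  move=> v vV; have [f fF zf] := Fn z Tz.
  have := chained_ball (d0 n) cV (FV f fF) vV.
  rewrite -natr1 mulrDl mul1r.
  have : (size V)%:R * d n <= C * r.
    by rewrite -ler_pdivlMr// (le_trans _ Qs)// ler_nat.
  have := dr n; have := metric_triangle z f v; have := d0 n.
  by move=> *; lra.
have [U [UU Uoo]] := ultraFilterLemma eventually_filter.
have dU e : 0 < e -> \forall n \near U, d n < e.
  move=> e0; apply: Uoo; have er0 : 0 < e / r by rewrite divr_gt0.
  apply: filterS (near_infty_natSinv_lt (PosNum er0)) => n /=.
  by rewrite ltr_pdivlMr// mulrC.
have Vr n v : v \in V n -> mdist z v <= (C + 2) * r by have [_ + _ _] := VP n; apply.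
have cV n : chained (d n) (V n) by have [] := VP n.
exists (limit_set U V); split.
- exact: closed_limit_set.
- exact: (connected_limit_set dX UU Uoo dU cV Vr).
- move=> p Tp e e0; apply: filterS (dU e e0) => n dn.
  have [_ _ + _] := VP n => /(_ p Tp)[v vV pv]; exists v => //.
  exact: lt_trans pv dn.
- by move=> p; exact: limit_set_bounded.
- apply: (packed_limit_set UU d0 dU cV C'1) => n y t dt.
  by have [_ _ _] := VP n; apply.
Qed.

(** * Gluing along a Whitney-type net *)

Lemma size_le_sum_count (T I : Type) (s : seq T) (t : seq I) (P : I -> pred T) :
  all (fun x => has (fun i => P i x) t) s ->
  (size s <= \sum_(i <- t) count (P i) s)%N.
Proof.
elim: s => [|x s IH] //= /andP[xt /IH {}IH].
rewrite big_split /= -add1n leq_add//.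
move: xt; rewrite has_count => /leq_trans; apply; rewrite -sum1_count big_mkcond /=.
by apply: leq_sum => i _; case: (P i x).
Qed.

Section gluing.
Context {R : realType}.

Lemma spread_pairs {X : metricType R} (e : R) (s : seq X) : uniq s ->
  (forall x y, x \in s -> y \in s -> x != y -> e <= mdist x y) -> spread e s.
Proof.
elim: s => //= a s IH /andP[aNs us] sep; apply/andP; split.
  apply/allP => x xs; apply: sep; rewrite ?inE ?eqxx ?xs ?orbT//.
  by apply: contra aNs => /eqP ->.
by apply: IH => // x y xs ys; apply: sep; rewrite inE ?xs ?ys orbT.
Qed.

(** Each of the at most [M] additional points in the ball is attached by one chain, over a distance
    of at most [2 * t]. *)
Lemma coverable_add {X : metricType R} (L C M : R) (K N T : set X) :
  quasiconvex L X -> 1 <= L -> 0 <= C -> coverable C K ->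
  (forall s, uniq s -> [set` s] `<=` N -> (size s)%:R <= M) ->
  T `<=` K `|` N -> coverable (C + 1 + M * (4 * L + 3)) T.
Proof.
move=> qX L1 C0 cK NM TKN d F d0 sp FT y t dt.
have M0 : 0 <= M by apply: (NM [::]) => // x.
have td : 1 <= t / d by rewrite ler_pdivlMr ?mul1r.
have td0 : 0 <= t / d by lra.
pose F1 := [seq x <- F | `[< K x >]].
pose F2 := [seq x <- F | ~~ `[< K x >] & mdist y x < t].
have F1K : [set` F1] `<=` K by move=> x /=; rewrite mem_filter => /andP[/asboolP].
have F2M : (size F2)%:R <= M.
  apply: NM; first by rewrite filter_uniq// (spread_uniq _ sp)//; lra.
  move=> x; rewrite /= mem_filter => /andP[/andP[/asboolPn nK _] xF].
  by have [] := TKN x (FT x xF).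
have [Q1 [cQ1 FQ1 Q1s]] := cK d F1 d0 (spread_filter _ sp) F1K y t dt.
have [Q0 [cQ0 Q0s Q10 Q0b]] : exists Q, [/\ chained d Q,
    (size Q)%:R <= C * t / d + 1, forall x, x \in F1 -> mdist y x < t -> x \in Q &
    (exists x, x \in F2) -> exists2 q, q \in Q & mdist y q < t].
  have [[x xF yx]|none] := pselect (exists2 x, x \in F1 & mdist y x < t).
    exists Q1; split => //; first lra.
    by move=> _; exists x => //; exact: FQ1.
  have [[x xF2]|none2] := pselect (exists x, x \in F2).
    exists [:: x]; split; first exact: chained1.
    - by rewrite /= lerDr mulr_ge0 ?invr_ge0 ?mulr_ge0//; lra.
    - by move=> w wF yw; exfalso; apply: none; exists w.
    - move=> _; exists x; first by rewrite mem_head.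
      by move: xF2; rewrite mem_filter => /andP[/andP[]].
  exists Q1; split => //; lra.
have L0 : 0 <= L by lra.
have t20 : 0 <= 2 * t by lra.
have [|Q [cQ Q0Q F2Q Qs]] := chained_extend (S := F2) qX L0 d0 t20 cQ0.
  move=> x xF2; have [|q qQ yq] := Q0b; first by exists x.
  exists q => //; move: xF2; rewrite mem_filter => /andP[/andP[_ yx] _].
  by have := metric_triangle q y x; rewrite (metric_sym q y); lra.
exists Q; split => //.
  move=> x xF yx; have [Kx|nKx] := boolP `[< K x >].
    by apply/Q0Q/Q10 => //; rewrite mem_filter Kx.
  by apply: F2Q; rewrite mem_filter nKx yx.
apply: (le_trans Qs).
have h : (size F2)%:R * (2 * L * (2 * t) / d + 3) <= M * ((4 * L + 3) * (t / d)).
  have -> : 2 * L * (2 * t) / d = 4 * L * (t / d) by ring.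
  have k0 : 0 <= 4 * L * (t / d) by rewrite mulr_ge0//; lra.
  by apply: ler_pM => //; lra.
lra.
Qed.

(** * Counting points of a Whitney-type net *)

Section net.
Context {X : metricType R}.
Context (D c : R) (x0 : X) (Z : set X).
Context (dX : doubling D X) (c0 : 0 < c) (c1 : 12 * c <= 1).
Context (Zx0 : forall z, Z z -> 0 < mdist x0 z)
  (Zsep : forall z z', Z z -> Z z' -> z <> z' -> c * mdist x0 z <= mdist z z').
Implicit Types (a b r : R).

Lemma net_size (a r q : R) y s : 0 < a -> 1 <= q -> r <= q * (c * a) -> uniq s ->
  (forall z, z \in s -> [/\ Z z, a <= mdist x0 z & mdist y z <= r]) ->
  (size s)%:R <= packing_bound D q.
Proof.
move=> a0 q1 rq us sP.
apply: (doubling_packing (x := y) (e := c * a) dX q1 _ rq).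
- by rewrite mulr_gt0.
- apply: spread_pairs => // z z' zs z's /eqP zz'.
  have [Zz az _] := sP z zs; have [Zz' _ _] := sP z' z's.
  by apply: le_trans (Zsep Zz Zz' zz'); rewrite ler_pM2l.
- by move=> z /sP[].
Qed.

(** Points of [Z] in the annulus are [c * a]-separated, so a maximal separated list already contains
    all of them. *)
Lemma annulus_finite a b : 0 < a -> exists s : seq X, uniq s /\
  forall z, z \in s <-> [/\ Z z, a <= mdist x0 z & mdist x0 z <= b].
Proof.
move=> a0; have ca : 0 < c * a by rewrite mulr_gt0.
pose q := `|b| / (c * a) + 1.
have q1 : 1 <= q by rewrite lerDr divr_ge0// ltW.
have bq : b <= q * (c * a).
  rewrite mulrDl mul1r divfK ?gt_eqF//.
  by rewrite (le_trans (ler_norm b))// lerDl ltW.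
have [|s [sp sZ sn]] := @maximal_spread _ _ (c * a)
    [set z | [/\ Z z, a <= mdist x0 z & mdist x0 z <= b]]
    (Num.truncn (packing_bound D q)) ca.
  move=> s sp sZ; rewrite truncn_ge_nat ?powR_ge0//.
  by apply: (net_size (y := x0) a0 q1 bq (spread_uniq ca sp)) => z /sZ.
exists s; split; first exact: spread_uniq sp.
move=> z; split; first exact: sZ.
move=> Pz; have [z' z's zz'] := sn z Pz.
have [<-//|/eqP ne] := eqVneq z' z.
have [Zz az _] := Pz; have [Zz' _ _] := sZ z' z's.
have := Zsep Zz Zz' (fun e => ne (esym e)).
have : c * a <= c * mdist x0 z by rewrite ler_pM2l.
lra.
Qed.

(* By doubling boundedly many points of [Z] lie in each dyadic annulus, so the
   sum is dominated by a geometric series. *)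
Lemma sum_net r s : 0 <= r -> uniq s ->
  (forall z, z \in s -> Z z /\ mdist x0 z <= r) ->
  \sum_(z <- s) mdist x0 z <= 2 * packing_bound D (2 / c) * r.
Proof.
set M := packing_bound D (2 / c).
have M0 : 0 <= M by rewrite powR_ge0.
have c2 : c <= 2 by move: c0 c1 => *; lra.
have [n] := ubnP (size s); elim: n s r => // n IH s r sn r0 us sZ.
case: s => [|z0 s0] in sn us sZ *; first by rewrite big_nil !mulr_ge0.
set s := z0 :: s0 in sn us sZ *.
(* With [k] the largest distance, the points beyond [k / 2] contribute at most [M * k]. The rest is
   shorter, as [m] is removed, and the induction hypothesis at radius [k / 2] again gives
   [M * k]. *)
have [m ms mmax] : exists2 m, m \in s & forall z, z \in s -> mdist x0 z <= mdist x0 m.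
  rewrite /s {sn us sZ s}; elim: s0 z0 => [|b u IHu] a.
    by exists a; rewrite ?mem_head// => z; rewrite inE => /eqP ->.
  have [m mu mmax] := IHu b; have [am|ma] := leP (mdist x0 a) (mdist x0 m).
    exists m; first by rewrite inE mu orbT.
    by move=> z; rewrite inE => /orP[/eqP ->|/mmax].
  exists a; rewrite ?mem_head// => z; rewrite inE => /orP[/eqP ->//|/mmax zm].
  by lra.
have [Zm mr] := sZ m ms; have m0 := Zx0 Zm; set k := mdist x0 m in mr m0 mmax.
rewrite (bigID (fun z => k / 2 < mdist x0 z)) /= -big_filter -[X in _ + X <= _]big_filter.
have big : \sum_(z <- [seq z <- s | k / 2 < mdist x0 z]) mdist x0 z <= M * k.
  apply: (@le_trans _ _ (\sum_(z <- [seq z <- s | k / 2 < mdist x0 z]) k)).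
    rewrite big_seq [leRHS]big_seq; apply: ler_sum => z.
    by rewrite mem_filter => /andP[_ /mmax].
  rewrite big_const_seq count_predT iter_addr_0 -[k *+ _]mulr_natl ler_wpM2r ?(ltW m0)//.
  apply: (@net_size (k / 2) k (2 / c) x0) => //.
  - by rewrite divr_gt0.
  - by rewrite ler_pdivlMr// mul1r; lra.
  - by have -> : 2 / c * (c * (k / 2)) = k by field; rewrite gt_eqF.
  - exact: filter_uniq.
  - move=> z; rewrite mem_filter => /andP[kz zs]; split; [|exact: ltW|exact: mmax].
    by have [] := sZ z zs.
have small : \sum_(z <- [seq z <- s | ~~ (k / 2 < mdist x0 z)]) mdist x0 z
    <= 2 * M * (k / 2).
  apply: IH.
  - apply: (@leq_trans (size s)); last exact: sn.
    rewrite size_filter.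
    have := count_predC (fun z => k / 2 < mdist x0 z) s; rewrite -/s => <-.
    rewrite -[X in (X < _)%N]add0n ltn_add2r -has_count; apply/hasP; exists m => //.
    by rewrite -/k; lra.
  - lra.
  - exact: filter_uniq.
  - move=> z; rewrite mem_filter -leNgt => /andP[zk zs]; split => //.
    by have [] := sZ z zs.
have : 2 * M * k <= 2 * M * r by rewrite ler_wpM2l// mulr_ge0.
lra.
Qed.

End net.

(** A maximal separated set exists by Zorn. An uncovered [w] could be added to it: the factor 5/4
    leaves room for the difference between the spacings at [w] and at [z]. *)
Lemma maximal_net {X : metricType R} (c : R) (x0 : X) : 0 < c -> 12 * c <= 1 ->
  exists Z : set X, [/\ forall z, Z z -> 0 < mdist x0 z,
    forall z z', Z z -> Z z' -> z <> z' -> c * mdist x0 z <= mdist z z' &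
    forall w, w <> x0 -> exists2 z, Z z & mdist z w < 5 / 4 * (c * mdist x0 z)].
Proof.
move=> c0 c1.
pose P := [set Z : set X | (forall z, Z z -> 0 < mdist x0 z) /\
  forall z z', Z z -> Z z' -> z <> z' -> c * mdist x0 z <= mdist z z'].
have [|Z [[Zx0 Zsep] Zmax]] := @Zorn_bigcup X P.
  move=> F FP tot; split; first by move=> z [A /FP[+ _] Az]; exact.
  move=> z z' [A FA Az] [B FB Bz'].
  have [AB|BA] := tot A B FA FB.
    by have [_] := FP B FB; apply => //; exact: AB.
  by have [_] := FP A FA; apply => //; exact: BA.
exists Z; split => // w wx0.
have w0 : 0 < mdist x0 w by rewrite mdist_gt0 eq_sym; apply/eqP.
apply: contrapT => far.
have Zw : ~ Z w.
  by move=> Zw; apply: far; exists w => //; rewrite mdistxx !mulr_gt0//; lra.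
apply: (Zmax (Z `|` [set w])); first by split => [z ?|/(_ w)]; [left|move=> h; apply/Zw/h; right].
have sepw z : Z z -> c * mdist x0 w <= mdist z w /\ c * mdist x0 z <= mdist z w.
  move=> Zz.
  have h : 5 / 4 * (c * mdist x0 z) <= mdist z w.
    by rewrite leNgt; apply/negP => lt; apply: far; exists z.
  have cz : 0 < c * mdist x0 z by rewrite mulr_gt0// Zx0.
  split; last by lra.
  have cw : c * mdist x0 w <= c * (mdist x0 z + mdist z w).
    by rewrite ler_pM2l// metric_triangle.
  have : 12 * (c * mdist z w) <= mdist z w by rewrite mulrA ler_piMl// mdist_ge0.
  lra.
split; first by move=> z [/Zx0//|->].
move=> z z' [Zz|->] [Zz'|->] zz'; [exact: Zsep|exact: (sepw z Zz).2| |by []].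
by rewrite (metric_sym w); exact: (sepw z' Zz').1.
Qed.

End gluing.

(** * The union of the pieces: closedness, connectedness, packing *)

Section glued.
Context {R : realType} {X : completeMetricType R}.
Context (D L c C : R) (x0 : X) (Z : set X) (G : X -> set X).
Context (dX : doubling D X) (qX : quasiconvex L X).
Context (c0 : 0 < c) (c1 : 12 * c <= 1) (C1 : 1 <= C).
Context (Zx0 : forall z, Z z -> 0 < mdist x0 z)
  (Zsep : forall z z', Z z -> Z z' -> z <> z' -> c * mdist x0 z <= mdist z z')
  (Zcov : forall w, w <> x0 -> exists2 z, Z z & mdist z w < 5 / 4 * (c * mdist x0 z)).
Context (clG : forall z, Z z -> closed (G z))
  (cG : forall z, Z z -> connected (G z))
  (Gnbr : forall z z', Z z -> Z z' -> mdist z z' < 3 * (c * mdist x0 z) -> G z z')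
  (Gdist : forall z p, Z z -> G z p -> mdist z p <= mdist x0 z / 2)
  (Gpk : forall z, Z z -> packed C (G z)).

Definition glued : set X := [set x0] `|` \bigcup_(z in Z) G z.

Lemma glued_dist z p : Z z -> G z p ->
  mdist x0 z <= 2 * mdist x0 p /\ mdist x0 p <= 3 / 2 * mdist x0 z.
Proof.
move=> Zz Gp; have := Gdist Zz Gp; have := Zx0 Zz.
have := metric_triangle x0 p z; have := metric_triangle x0 z p.
by rewrite (metric_sym p z); split; lra.
Qed.

Lemma glued_self z : Z z -> G z z.
Proof. by move=> Zz; apply: Gnbr => //; rewrite mdistxx !mulr_gt0// Zx0. Qed.

Lemma glued_sub z : Z z -> G z `<=` glued.
Proof. by move=> Zz p Gp; right; exists z. Qed.

(** Away from [x0] the pieces are locally finite: those close to [p] have their points [z] in a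
    fixed annulus. They can accumulate only at [x0], which belongs to [glued]. *)
Lemma glued_closed : closed glued.
Proof.
move=> p clp; have [->|/eqP px0] := eqVneq p x0; first by left.
have p0 : 0 < mdist x0 p by rewrite mdist_gt0 eq_sym; apply/eqP.
have p40 : 0 < mdist x0 p / 4 by lra.
have [s [us sP]] := annulus_finite dX c0 Zsep (2 * mdist x0 p * 2) p40.
have cU : closed (\bigcup_(z in [set` s]) G z).
  apply: closed_bigcup; first exact: finite_seq.
  by move=> z /sP[Zz _ _]; exact: clG.
right; have [z zs Gp] : (\bigcup_(z in [set` s]) G z) p.
  apply: closed_mdist cU _ => e e0.
  pose e' := Num.min e (mdist x0 p / 4).
  have e'0 : 0 < e' by rewrite lt_min e0.
  have [q [Gq]] := clp _ (nbhsx_ballx p _ e'0).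
  rewrite mem_ball_mdist lt_min => /andP[pq pq4]; exists q => //.
  have qp := metric_triangle x0 q p; have pq' := metric_triangle x0 p q.
  rewrite (metric_sym q p) in qp.
  case: Gq => [qx0|[z Zz Gz]].
    by move: pq4; rewrite qx0 metric_sym; lra.
  have [zq qz] := glued_dist Zz Gz; exists z => //; apply/sP.
  by split => //; lra.
by exists z => //; have /sP[] := zs.
Qed.

(* The component of [z] contains points arbitrarily close to [x0]: otherwise the
   points of [Z] inside it and those outside it would separate a curve joining
   [z] to [x0]. *)
Lemma glued_component z : Z z -> connected_component glued z x0.
Proof.
move=> Zz; set E := connected_component glued z.
have cE : closed E by apply: component_closed; exact: glued_closed.
have Ez : E z by apply: connected_component_refl; exact: (glued_sub Zz (glued_self Zz)).
have EG z' : Z z' -> E z' -> G z' `<=` E.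
  move=> Zz' Ez' p Gp; apply: connected_component_trans Ez' _.
  exists (G z') => //; split; [exact: glued_self|exact: glued_sub|exact: cG].
apply: closed_mdist cE _ => e e0; apply: contrapT => none.
have far p : E p -> e <= mdist x0 p.
  by move=> Ep; rewrite leNgt; apply/negP => lt; apply: none; exists p.
have [g [cg g0 g1 _]] := qX z x0.
have cI : connected (g @` `[0, 1]%classic).
  by apply: connected_continuous_connected cg; exact: segment_connected.
pose B z' := ball z' (5 / 4 * (c * mdist x0 z')).
pose U := \bigcup_(z' in Z `&` E) B z'.
pose U' := ball x0 (e / 2) `|` \bigcup_(z' in Z `&` ~` E) B z'.
(* Overlapping balls have neighbouring centres, so [z2] lies in the piece of [z1] and hence in [E].
   The ball around [x0] is missed because points of [E] are at distance at least [e] from [x0]. *)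
have UU' w : U w -> U' w -> False.
  move=> [z1 [Zz1 Ez1]]; rewrite /B mem_ball_mdist => z1w.
  have h1 : 12 * (c * mdist x0 z1) <= mdist x0 z1.
    by rewrite mulrA ler_piMl// mdist_ge0.
  have t1 := metric_triangle x0 w z1; have f1 := far z1 Ez1.
  rewrite (metric_sym w z1) in t1.
  case; first by rewrite mem_ball_mdist => x0w; lra.
  move=> [z2 [Zz2 nEz2]]; rewrite /B mem_ball_mdist => z2w; apply: nEz2.
  apply: (EG z1) => //; apply: Gnbr => //.
  have t2 := metric_triangle z1 w z2; rewrite (metric_sym w z2) in t2.
  have t3 := metric_triangle x0 z1 z2.
  have h2 : 12 * (c * mdist x0 z2) <= mdist x0 z2.
    by rewrite mulrA ler_piMl// mdist_ge0.
  have h3 : c * mdist x0 z2 <= c * (mdist x0 z1 + mdist z1 z2) by rewrite ler_pM2l.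
  have h4 : 12 * (c * mdist z1 z2) <= mdist z1 z2.
    by rewrite mulrA ler_piMl// mdist_ge0.
  have h5 : 0 < c * mdist x0 z1 by rewrite mulr_gt0// Zx0.
  lra.
have : g @` `[0, 1]%classic `<=` U.
  apply: (@connected_sub_open _ _ _ U U') => //.
  - by apply: bigcup_open => q _; exact: open_ball_mdist.
  - apply: openU; first exact: open_ball_mdist.
    by apply: bigcup_open => q _; exact: open_ball_mdist.
  - move=> w _; have [->|/eqP wx0] := eqVneq w x0.
      by right; left; rewrite mem_ball_mdist mdistxx; lra.
    have [z' Zz' z'w] := Zcov wx0.
    have [Ez'|nEz'] := pselect (E z'); first by left; exists z'; rewrite // /B mem_ball_mdist.
    by right; right; exists z'; rewrite // /B mem_ball_mdist.
  - exists z; split; first by exists 0; rewrite //= in_itv /= lexx ler01.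
    by exists z => //; rewrite /B mem_ball_mdist mdistxx !mulr_gt0// Zx0.
move=> /(_ x0) Ux0; apply: (UU' x0).
  by apply: Ux0; exists 1; rewrite //= in_itv /= lexx ler01.
by left; rewrite mem_ball_mdist mdistxx; lra.
Qed.

Lemma glued_connected : connected glued.
Proof.
suff -> : glued = connected_component glued x0 by exact: component_connected.
apply/seteqP; split; last exact: connected_component_sub.
move=> p [->|[z Zz Gp]]; first by apply: connected_component_refl; left.
apply: connected_component_trans (connected_component_sym (glued_component Zz)) _.
exists (G z) => //; split; [exact: glued_self|exact: glued_sub|exact: cG].
Qed.

Lemma glued_count (s t : seq X) (e : R) (b : X -> R) :
  spread e s -> (forall z, z \in t -> Z z) ->
  (forall p, p \in s -> exists2 z, z \in t & G z p) ->
  (forall z s', z \in t -> spread e s' -> {subset s' <= s} -> [set` s'] `<=` G z ->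
    (size s')%:R <= b z) ->
  (size s)%:R <= \sum_(z <- t) b z.
Proof.
move=> sp tZ sG sb.
have h : (size s <= \sum_(z <- t) count (fun p => `[< G z p >]) s)%N.
  apply: size_le_sum_count; apply/allP => p ps.
  by have [z zt Gp] := sG p ps; apply/hasP; exists z => //; exact/asboolP.
apply: (@le_trans _ _ (\sum_(z <- t) count (fun p => `[< G z p >]) s)%N%:R).
  by rewrite ler_nat.
rewrite natr_sum big_seq [leRHS]big_seq; apply: ler_sum => z zt.
rewrite -size_filter; apply: sb => //; first exact: spread_filter.
- by move=> p; rewrite mem_filter => /andP[].
- by move=> p /=; rewrite mem_filter => /andP[/asboolP].
Qed.

(** A ball far from [x0] meets boundedly many pieces, each contributing [C * r / e]. For a ball
    comparable to one around [x0], doubling counts the points within [2 * e] of [x0], and the others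
    lie in pieces contributing [C * mdist x0 z / e], summed by [sum_net]. *)
Lemma glued_packed : packed (C * packing_bound D (5 / c) +
  40 * C * packing_bound D (2 / c) + packing_bound D 2) glued.
Proof.
set M1 := packing_bound D (5 / c); set M2 := packing_bound D (2 / c).
have M10 : 0 < M1 by rewrite packing_bound_gt0// divr_gt0.
have M20 : 0 < M2 by rewrite packing_bound_gt0// divr_gt0.
set M3 := packing_bound D 2.
have M30 : 0 < M3 by rewrite packing_bound_gt0.
have C0 : 0 <= C by exact: le_trans C1.
have c5 : c <= 5 by move: c0 c1 => *; lra.
move=> y e r s e0 er sp sG; have r0 : 0 < r by lra.
have re : 1 <= r / e by rewrite ler_pdivlMr ?mul1r.
have CM1 : 0 <= C * M1 * (r / e) by rewrite !mulr_ge0 ?invr_ge0//; exact: ltW.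
have CM2 : 0 <= C * M2 * (r / e) by rewrite !mulr_ge0 ?invr_ge0//; exact: ltW.
have M3r : M3 <= M3 * (r / e) by rewrite ler_peMr// ltW.
have sy p : p \in s -> glued p /\ mdist y p < r.
  by move=> /sG[Gp]; rewrite mem_ball_mdist.
rewrite -mulrA !mulrDl.
have [small|large] := ltP (4 * r) (mdist x0 y).
- have y20 : 0 < mdist x0 y / 2 by lra.
  have [t [ut tP]] := annulus_finite dX c0 Zsep (5 / 2 * mdist x0 y) y20.
  have tM : (size t)%:R <= M1.
    apply: (net_size dX c0 Zsep y20 (y := x0) (r := 5 / 2 * mdist x0 y)) => //.
    + by rewrite ler_pdivlMr// mul1r; lra.
    + by have -> : 5 / c * (c * (mdist x0 y / 2)) = 5 / 2 * mdist x0 y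
        by field; rewrite gt_eqF.
    + by move=> z /tP.
  have : (size s)%:R <= \sum_(z <- t) (C * r / e).
    apply: (glued_count sp).
    + by move=> z /tP[].
    + move=> p /sy[Gp yp].
      have t1 := metric_triangle x0 p y; have t2 := metric_triangle x0 y p.
      rewrite (metric_sym p y) in t1.
      case: Gp => [px0|[z Zz Gp]]; first by rewrite px0 in t1 yp; rewrite mdistxx in t1; lra.
      have [zp pz] := glued_dist Zz Gp; exists z => //; apply/tP; split => //; lra.
    + move=> z s' /tP[Zz _ _] s'sp s's s'G; apply: (Gpk Zz (y := y)) => //.
      move=> p ps'; split; first exact: s'G.
      by rewrite mem_ball_mdist; have [] := sy p (s's p ps').
  rewrite big_const_seq count_predT iter_addr_0 -[_ *+ size t]mulr_natl.
  have : (size t)%:R * (C * r / e) <= M1 * (C * r / e).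
    by rewrite ler_wpM2r// divr_ge0 ?(ltW e0)// mulr_ge0//; lra.
  lra.
- pose s1 := [seq p <- s | mdist x0 p <= 2 * e].
  pose s2 := [seq p <- s | ~~ (mdist x0 p <= 2 * e)].
  have s12 : (size s)%:R = (size s1)%:R + (size s2)%:R :> R.
    by rewrite -natrD !size_filter (count_predC (fun p => mdist x0 p <= 2 * e)%R s).
  have s1M : (size s1)%:R <= M3.
    apply: (doubling_packing (x := x0) (e := e) (r := 2 * e) dX) => //.
    + by lra.
    + exact: spread_filter.
    + by move=> p; rewrite mem_filter => /andP[].
  have [t [ut tP]] := annulus_finite dX c0 Zsep (10 * r) e0.
  have s2M : (size s2)%:R <= \sum_(z <- t) (C * mdist x0 z / e).
    apply: (glued_count (e := e)); first exact: spread_filter.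
    + by move=> z /tP[].
    + move=> p; rewrite mem_filter -ltNge => /andP[pe /sy[Gp yp]].
      have t2 := metric_triangle x0 y p.
      case: Gp => [px0|[z Zz Gp]]; first by move: pe; rewrite px0 mdistxx; lra.
      have [zp pz] := glued_dist Zz Gp; exists z => //; apply/tP; split => //; lra.
    + move=> z s' /tP[Zz ez _] s'sp s's s'G; apply: (Gpk Zz (y := z)) => //.
      move=> p ps'; have Gp := s'G p ps'; split => //.
      by rewrite mem_ball_mdist; have := Gdist Zz Gp; have := Zx0 Zz; lra.
  have r100 : 0 <= 10 * r by lra.
  have tZ z : z \in t -> Z z /\ mdist x0 z <= 10 * r by move=> /tP[].
  have := sum_net dX c0 c1 Zx0 Zsep r100 ut tZ; rewrite -/M2 => tM.
  have : \sum_(z <- t) (C * mdist x0 z / e) <= (C / e) * (2 * M2 * (10 * r)).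
    rewrite (eq_bigr (fun z => (C / e) * mdist x0 z)); last first.
      by move=> z _; rewrite mulrAC.
    by rewrite -mulr_sumr ler_wpM2l// divr_ge0//; lra.
  lra.
Qed.

End glued.

(** * Covers of unbounded sets and their regularity *)

Lemma unbounded_cover {R : realType} (D L C : R) : 1 <= L -> 0 <= C ->
  exists2 C', 1 <= C' & forall (X : completeMetricType R) (K : set X),
  doubling D X -> quasiconvex L X -> coverable C K ->
  exists G, [/\ closed G, connected G, K `<=` G & packed C' G].
Proof.
move=> L1 C0; pose M := packing_bound D 4.
have M0 : 0 <= M by rewrite powR_ge0.
pose CT := C + 1 + M * (4 * L + 3).
have CT0 : 0 <= CT by rewrite /CT !addr_ge0// mulr_ge0//; lra.
have [C' C'1 cover] := bounded_cover D L1 CT0.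
(* The covers of [bounded_cover] stay within [3 c (CT + 2)] times [mdist x0 z] of
   [z]; the constant [CT] does not depend on [c], as it counts net points at a
   fixed ratio to the spacing. *)
pose c := (12 * (CT + 2))^-1.
have c0 : 0 < c by rewrite invr_gt0; lra.
have c1 : 12 * c <= 1.
  have -> : 12 * c = (CT + 2)^-1 by rewrite /c; field; lra.
  by rewrite invf_le1; lra.
pose C'' := C' * packing_bound D (5 / c) + 40 * C' * packing_bound D (2 / c) +
  packing_bound D 2.
exists (1 + C''); first by rewrite lerDl !addr_ge0 ?powR_ge0 ?mulr_ge0 ?powR_ge0//; lra.
move=> X K dX qX cK; pose x0 : X := point.
have [Z [Zx0 Zsep Zcov]] := maximal_net x0 c0 c1.
(* Including the net points makes the piece of [z] contain the neighbours of [z], which is what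
   links the pieces. *)
pose T z := (K `|` Z) `&` ball z (3 * (c * mdist x0 z)).
have cT z : Z z -> coverable CT (T z).
  move=> Zz; apply: (@coverable_add _ _ L C M K (Z `&` ball z (3 * (c * mdist x0 z)))) => //.
    (* Points of the ball are at distance at least 3/4 of [mdist x0 z] from [x0], so the ratio of
       radius to spacing is 4, as in [M]. *)
    move=> s us sN; have z0 := Zx0 z Zz; have z20 : 0 < mdist x0 z * (3 / 4) by lra.
    apply: (net_size dX c0 Zsep z20 (y := z) (r := 3 * (c * mdist x0 z))) => //.
    - by lra.
    - by lra.
    move=> w ws; have [Zw] := sN w ws; rewrite mem_ball_mdist => zw; split => //; last exact: ltW.
    have := metric_triangle x0 w z; rewrite (metric_sym w z).
    have : 12 * (c * mdist x0 z) <= mdist x0 z by rewrite mulrA ler_piMl// mdist_ge0.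
    lra.
  by move=> w [[Kw|Zw] zw]; [left|right].
have /choice[G GP] : forall z, exists G, Z z -> [/\ closed G, connected G, T z `<=` G,
    forall p, G p -> mdist z p <= mdist x0 z / 2 & packed C' G].
  move=> z; have [Zz|nZz] := pselect (Z z); last by exists set0.
  have z0 := Zx0 z Zz; have cz0 : 0 < c * mdist x0 z by rewrite mulr_gt0.
  have [|||G [clG cG TG Gz pG]] := cover X (T z) z (3 * (c * mdist x0 z)) dX qX (cT z Zz).
  - by split; [right|rewrite mem_ball_mdist mdistxx; lra].
  - lra.
  - by move=> w [].
  exists G => _; split => // p /Gz.
  have -> : (CT + 2) * (3 * (c * mdist x0 z)) = mdist x0 z / 4 by rewrite /c; field; lra.
  lra.
have TG z w : Z z -> (K `|` Z) w -> mdist z w < 3 * (c * mdist x0 z) -> G z w.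
  move=> Zz KZw zw; have [_ _ + _ _] := GP z Zz; apply; split => //.
  by rewrite mem_ball_mdist.
exists (glued x0 Z G); split.
- by apply: (@glued_closed _ _ D c) => // [z /GP[]//|z p /GP[_ _ _ + _]]; apply.
- apply: (@glued_connected _ _ D L c) => // [z /GP[]//|z /GP[]//|z z' Zz Zz'|z p /GP[_ _ _ + _]].
    by apply: TG => //; right.
  by apply.
- move=> k Kk; have [->|/eqP kx0] := eqVneq k x0; first by left.
  have [z Zz zk] := Zcov k kx0; right; exists z => //; apply: TG => //; first by left.
  by have : 0 < c * mdist x0 z; [rewrite mulr_gt0// Zx0|lra].
- have pk : packed C'' (glued x0 Z G).
    by apply: (@glued_packed _ _ D c) => // [z p /GP[_ _ _ + _]|z /GP[]//]; apply.
  move=> y e r s e0 er sp sG; apply: (le_trans (pk y e r s e0 er sp sG)).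
  have : 0 <= r / e by rewrite divr_ge0//; lra.
  by rewrite -!mulrA; lra.
Qed.

(** The balls of radius [e] around a maximal [e]-separated set form a cover: at most [C * r / e]
    sets of diameter at most [2 * e]. *)
Lemma hausdorff1_packed {R : realType} {X : completeMetricType R} (C : R) (G : set X) x r :
  0 < r -> packed C G -> (hausdorff1 (ball x r `&` G) <= (2 * C * r)%:E)%E.
Proof.
move=> r0 pG; apply: ge_ereal_sup => _ [delta /= d0 <-].
pose e := Num.min r (delta / 2).
have e0 : 0 < e by rewrite lt_min r0; lra.
have er : e <= r by rewrite ge_min lexx.
have ed : 2 * e <= delta.
  by have : e <= delta / 2; [rewrite ge_min lexx orbT|lra].
have bnd s : spread e s -> [set` s] `<=` ball x r `&` G -> (size s)%:R <= C * r / e.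
  by move=> sp sG; apply: (pG x) => //; rewrite setIC.
have [|s [sp sG sn]] := @maximal_spread _ _ e (ball x r `&` G)
    (Num.truncn (C * r / e)) e0.
  move=> s sp sG; have := bnd s sp sG => ss.
  by rewrite truncn_ge_nat// (le_trans _ ss).
pose E i := if (i < size s)%N then ball (nth x s i) e else set0.
have dE i : (diam (E i) <= (if (i < size s)%N then 2 * e else 0)%:E)%E.
  rewrite /E; case: ifPn => _; last by rewrite diam0.
  apply: diam_le; first lra.
  move=> p q; rewrite !mem_ball_mdist => np nq.
  by have := metric_triangle p (nth x s i) q; rewrite (metric_sym p (nth x s i)); lra.
apply: (@le_trans _ _ (\sum_(i <oo) diam (E i))%E).
  apply: ereal_inf_lbound; exists E => //; split.
    move=> p Gp; have [q qs pq] := sn p Gp; exists (index q s) => //.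
    by rewrite /E index_mem qs nth_index// mem_ball_mdist metric_sym.
  move=> i; apply: (le_trans (dE i)); rewrite lee_fin; case: ifPn => _ //.
  exact: ltW.
rewrite (nneseries_split 0 (size s)); last by move=> *; exact: diam_ge0.
rewrite add0n eseries0 ?adde0; last first.
  by move=> i si _; rewrite /E ltnNge si /= diam0.
apply: (@le_trans _ _ (\sum_(0 <= i < size s) (2 * e)%:E)%E).
  rewrite !big_mkord; apply: lee_sum => i _.
  by apply: (le_trans (dE i)); rewrite ltn_ord.
rewrite sumEFin lee_fin big_const_nat subn0 iter_addr_0 -[_ *+ size s]mulr_natl.
have := bnd s sp sG; rewrite ler_pdivlMr//; lra.
Qed.

Lemma unbounded_far {R : realType} {X : metricType R} (K : set X) x (M : R) :
  diam K = +oo%E -> exists2 y, K y & M <= mdist x y.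
Proof.
move=> Koo; apply: contrapT => none.
have near y : K y -> mdist x y <= `|M|.
  move=> Ky; rewrite leNgt; apply/negP => lt; apply: none; exists y => //.
  by rewrite (le_trans (ler_norm M))// ltW.
have : (diam K <= (2 * `|M|)%:E)%E.
  apply: diam_le; first by rewrite mulr_ge0.
  move=> y z /near xy /near xz; have := metric_triangle y x z.
  by rewrite (metric_sym y x); lra.
by rewrite Koo.
Qed.

Lemma regular_cover {R : realType} (D L C : R) : 1 <= L -> 0 <= C ->
  exists2 C', 1 <= C' & forall (X : completeMetricType R) (K : set X),
  doubling D X -> quasiconvex L X -> diam K = +oo%E -> coverable C K ->
  exists G0 : set X,
    [/\ connected G0, regular1 C' G0 & K `<=` G0] /\
    [/\ (hausdorff1 G0 <= C'%:E * diam K)%E,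
        is_minimum (hausdorff1 @` closed_connected_cover K) (hausdorff1 G0),
        hausdorff1 G0 = +oo%E & (C'%:E * diam K)%E = +oo%E].
Proof.
move=> L1 C0; have [C' C'1 cover] := unbounded_cover D L1 C0.
exists (2 * C'); first lra.
move=> X K dX qX Koo cK; have [G [clG cG KG pG]] := cover X K dX qX cK.
(* A connected set has at least half the distance of any two of its points as measure, and [K] has
   points arbitrarily far apart. *)
have infinite (H : set X) : closed_connected_cover K H -> hausdorff1 H = +oo%E.
  move=> [_ cH KH]; have [k Kk _] := unbounded_far point 0 Koo.
  apply/eqyP => M M0; have [y Ky ky] := unbounded_far k (2 * M) Koo.
  apply: le_trans (hausdorff1_ge cH (KH _ Kk) (KH _ Ky)).
  by rewrite lee_fin; lra.
have coverG : closed_connected_cover K G by [].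
have C'K : ((2 * C')%:E * diam K)%E = +oo%E by rewrite Koo gt0_muley// lte_fin; lra.
exists G; split; split => //.
- split => //.
    have : (diam K <= diam G)%E by exact: diam_subset.
    by rewrite Koo leye_eq => /eqP ->.
  move=> x r Gx r0 _; rewrite hausdorff1_packed// andbT.
  (* Lower regularity: [G] is connected and leaves every ball, so its part in the ball has measure
     at least [r / 2]. *)
  have [y Ky xy] := unbounded_far x r Koo.
  apply: le_trans (hausdorff1_ball_ge cG Gx (KG _ Ky) xy).
  rewrite lee_fin mulrC ler_pM2l// lef_pV2 ?posrE; lra.
- by rewrite C'K leey.
- split; first by exists G.
  by move=> _ [H HK <-]; rewrite (infinite G)// (infinite H).
- exact: infinite.
Qed.

Theorem corollary3p14 (R : realType) (D L C : R)
    (D1 : 1 <= D) (L1 : 1 <= L) (C0 : 0 < C) :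
  (exists2 C' : R, 1 <= C' &
    forall (X : completeMetricType R) (K : set X),
      doubling D X -> quasiconvex L X -> diam K = +oo%E ->
      (forall (x : X) (r : R), K x -> 0 < r ->
        exists2 G : set X, closed_connected_cover (K `&` ball x r) G &
          (hausdorff1 G <= (C * r)%:E)%E) ->
      exists G0 : set X,
        [/\ connected G0, regular1 C' G0 & K `<=` G0] /\
        [/\ (hausdorff1 G0 <= C'%:E * diam K)%E,
            is_minimum (hausdorff1 @` closed_connected_cover K)
              (hausdorff1 G0),
            hausdorff1 G0 = +oo%E & (C'%:E * diam K)%E = +oo%E])
  /\
  (exists2 C' : R, 1 <= C' &
    forall (X : completeMetricType R) (K : set X),
      doubling D X -> quasiconvex L X -> diam K = +oo%E ->
      (forall (x : X) (r : R), K x -> 0 < r ->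
        exists (A : set R) (f : R -> X),
          [/\ A `<=` `[0, 1], f @` A = K `&` ball x r &
            lipschitz_map_on (C * r) A f]) ->
      exists G0 : set X,
        [/\ connected G0, regular1 C' G0 & K `<=` G0] /\
        [/\ (hausdorff1 G0 <= C'%:E * diam K)%E,
            is_minimum (hausdorff1 @` closed_connected_cover K)
              (hausdorff1 G0),
            hausdorff1 G0 = +oo%E & (C'%:E * diam K)%E = +oo%E]).
Proof.
have L0 : 0 <= L by lra.
split.
- have C1 : 0 <= 2 * (2 + 32 * C) by lra.
  have [C' C'1 cover] := regular_cover D L1 C1; exists C' => // X K dX qX Koo KC.
  by apply: cover => //; exact: coverable_continua.
- have C1 : 0 <= 2 * (1 + (2 * L + 6) * C).
    by rewrite mulr_ge0// addr_ge0// mulr_ge0; lra.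
  have [C' C'1 cover] := regular_cover D L1 C1; exists C' => // X K dX qX Koo KC.
  by apply: cover => //; exact: coverable_lipschitz.
Qed.
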